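(* Let $0<\delta<1$, $0<\epsilon<1$, $\lambda>0$, and assume (LipS), (SmS* ) and (SCS* ). Let $x^{(k)}\in\mathcal D\cap\mathcal X$, draw $\mathcal S$ with $|\mathcal S|\ge16(K^* )^2\ln(2p/\delta)/((\gamma^* )^2\epsilon^2)$, let $\hat H(x^{(k)})=\mathcal P(\lambda;H(x^{(k)}))$, and let $x^{(k+1)}$ be given by the update with $\mathbf g=\nabla F(x^{(k)})$, $M=\hat H(x^{(k)})$, $\alpha_k=1$. If $\lambda\ge(1-\epsilon)\gamma^*$, then with probability $1-\delta$, $$\|x^{(k+1)}-x^*\|\le\rho_0\|x^{(k)}-x^*\|+\xi\|x^{(k)}-x^*\|^2,\qquad \rho_0=\frac{\lambda-(1-\epsilon)\gamma^*+\gamma^*\epsilon}{\lambda},\quad\xi=\frac{(\sqrt p+1/2)L}{\lambda}.$$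
   Context: $f_1,\dots,f_n$ are twice differentiable real functions with domains $\mathrm{dom}(f_i)\subseteq\mathbb R^p$; $\mathcal D=\bigcap_i\mathrm{dom}(f_i)$ is open and convex, $\mathcal X\subseteq\mathbb R^p$ is convex, $F=\frac1n\sum_{i=1}^n f_i$, and $x^*$ is a local minimum of $F$ over $\mathcal D\cap\mathcal X$. $\|\cdot\|$ is the Euclidean/spectral norm and $\lambda_{\min}$ the usual smallest eigenvalue. (LipS): there is $L>0$ with $\|\nabla^2f_i(x)-\nabla^2f_i(x^* )\|\le L\|x-x^*\|$ for all $x\in\mathcal D\cap\mathcal X$ and all $i$. (SmS* ): $K^*:=\max_i\|\nabla^2 f_i(x^* )\|<\infty$. (SCS* ): $\gamma^*:=\lambda_{\min}(\nabla^2F(x^* ))>0$. Sub-sampled Hessian: for a collection $\mathcal S$ of indices drawn uniformly at random from $\{1,\dots,n\}$, $H(x)=\frac1{|\mathcal S|}\sum_{j\in\mathcal S}\nabla^2f_j(x)$. Spectral regularization: for symmetric $H=\sum_i\lambda_i(H)v_iv_i^T$, $\mathcal P(\lambda;H)=\sum_{i=1}^p\max\{\lambda_i(H),\lambda\}v_iv_i^T$. Update: $x^{(k+1)}=\arg\min_{x\in\mathcal D\cap\mathcal X}\{F(x^{(k)})+(x-x^{(k)})^T\mathbf g+\frac1{2\alpha_k}(x-x^{(k)})^TM(x-x^{(k)})\}$. *)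

(* Defs.v *)
From HB Require Import structures.
From mathcomp Require Import all_boot all_order all_algebra.
From mathcomp Require Import all_classical all_reals all_analysis.
Import Order.TTheory GRing.Theory Num.Theory.
Import numFieldNormedType.Exports.
Set Implicit Arguments. Unset Strict Implicit. Unset Printing Implicit Defensive.
Local Open Scope classical_set_scope.
Local Open Scope ring_scope.

Section Defs.
Variables (R : realType) (p : nat).

Definition enorm (v : 'cV[R]_p) : R := Num.sqrt (\sum_(i < p) (v i 0) ^+ 2).

Definition specnorm (A : 'M[R]_p) : R :=
  sup [set enorm (A *m x) | x in [set x : 'cV[R]_p | enorm x <= 1]].

Definition is_lambda_min (A : 'M[R]_p) (g : R) : Prop :=
  eigenvalue A g /\ forall a : R, eigenvalue A a -> g <= a.

Definition evec (j : 'I_p) : 'cV[R]_p := delta_mx j 0.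

Definition grad (f : 'cV[R]_p -> R) (x : 'cV[R]_p) : 'cV[R]_p :=
  \col_(j < p) ('D_(evec j) f x).

Definition hess (f : 'cV[R]_p -> R) (x : 'cV[R]_p) : 'M[R]_p :=
  \matrix_(i < p, j < p) (('D_(evec j) (grad f) x) i 0).

Definition twice_diff_on (D : set 'cV[R]_p) (f : 'cV[R]_p -> R) : Prop :=
  forall x, D x -> differentiable f x /\ differentiable (grad f) x.

Definition local_min_on (F : 'cV[R]_p -> R) (C : set 'cV[R]_p) (xs : 'cV[R]_p) : Prop :=
  C xs /\ exists r : R, 0 < r /\ forall x, C x -> enorm (x - xs) < r -> F xs <= F x.

Definition spectral_reg (lam : R) (H M : 'M[R]_p) : Prop :=
  exists (V : 'M[R]_p) (d : 'rV[R]_p),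
    V^T *m V = 1%:M /\ H = V *m diag_mx d *m V^T /\
    M = V *m diag_mx (\row_i Num.max (d 0 i) lam) *m V^T.

Definition qmodel (Fxk : R) (xk g : 'cV[R]_p) (alpha : R) (M : 'M[R]_p)
  (x : 'cV[R]_p) : R :=
  Fxk + ((x - xk)^T *m g) 0 0 + (2 * alpha)^-1 * ((x - xk)^T *m M *m (x - xk)) 0 0.

Definition is_argmin_on (C : set 'cV[R]_p) (q : 'cV[R]_p -> R) (y : 'cV[R]_p) : Prop :=
  C y /\ forall x, C x -> q y <= q x.

End Defs.

(* sub-sampled Hessian with the multiset S of s indices drawn i.i.d. uniformly *)
Definition subH (R : realType) (p n s : nat) (f : 'I_n -> 'cV[R]_p -> R)
  (S : {ffun 'I_s -> 'I_n}) (x : 'cV[R]_p) : 'M[R]_p :=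
  (s%:R)^-1 *: \sum_(j < s) hess (f (S j)) x.

Definition prob_draw (R : realType) (n s : nat) (E : {ffun 'I_s -> 'I_n} -> Prop) : R :=
  (#|[set S : {ffun 'I_s -> 'I_n} | `[< E S >]]|%:R / #|{ffun 'I_s -> 'I_n}|%:R).

(* Main.v *)
Require Import Defs.
From HB Require Import structures.
From mathcomp Require Import all_boot all_order all_algebra.
From mathcomp Require Import all_classical all_reals all_analysis.
From mathcomp Require Import complex ring lra.
Import Order.TTheory GRing.Theory Num.Theory.
Import numFieldNormedType.Exports.
Set Implicit Arguments.
Unset Strict Implicit.
Local Open Scope classical_set_scope.
Local Open Scope ring_scope.

(** The optimality conditions of [y] (for the quadratic model) and of [xstar] (for
    [F]) give, with [e = xk - xstar], [D = y - xstar] and [G] the increment of the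
    gradient of [F] from [xstar] to [xk],
      [lam |D|^2 <= D^T M D <= D^T (M e - G)].
    Let [T] be the sub-sampled Hessian at [xstar] and [M' = P(lam; T)]. Then
      [M e - G = (M - M') e + (M' - T) e + (T - hess F xstar) e + (hess F xstar e - G)],
    where the three matrices have operator norms at most, respectively,
    - the Frobenius distance from the sub-sampled Hessian at [xk] to [T], since
      [P(lam; .)] is 1-Lipschitz for the Frobenius norm (hence the [sqrt p]);
    - [lam - (1 - eps) gst], since the eigenvalues of [T] are at least [(1 - eps) gst];
    - [gst eps], with probability at least [1 - delta];
    and [D^T (hess F xstar e - G) <= L / 2 |e|^2 |D|] by the mean value theorem.
    The probability estimate comes from the moments [E tr X^(2m)] of the sum [X] of the
    centered samples. The exchangeable pair obtained by resampling one index and the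
    trace inequality
      [tr ((X - Y) (X^(2r+1) - Y^(2r+1))) <= (2r+1)/2 tr ((X - Y)^2 (X^(2r) + Y^(2r)))]
    yield [E tr X^(2m) <= p (2m-1)!! (2 s K^2)^m], and Markov's inequality with [m]
    about [ln (2 p / delta)] concludes. *)

(** * Spectral theorem for real symmetric matrices *)

(** Over the complex numbers the matrix has an eigenvalue [z] with row eigenvector [u + i v].
    Symmetry equates [u A v^T] and [v A u^T], which forces [Im z * (|u|^2 + |v|^2) = 0]; so [z] is
    real, and whichever of [u], [v] is nonzero is a real eigenvector. *)
Lemma symmetric_eigenvector (R : rcfType) n (A : 'M[R]_n.+1) : A^T = A ->
  exists (a : R) (v : 'cV[R]_n.+1), v != 0 /\ A *m v = a *: v.
Proof.
move=> symA.
have [z /eigenvalueP [w wz w0]] :=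
  eigenvalue_closed (map_mx (real_complex R) A) (ltn0Sn n).
pose u := map_mx (@complex.Re R) w; pose v := map_mx (@complex.Im R) w.
have wE j : \sum_i w 0 i * (A i j)%:C%C = z * w 0 j.
  have := congr1 (fun M => fun_of_matrix M 0 j) wz; rewrite !mxE => <-.
  by apply: eq_bigr => i _; rewrite mxE.
have uE : u *m A = complex.Re z *: u - complex.Im z *: v.
  apply/rowP => j; rewrite !mxE.
  have /(congr1 (@complex.Re R)) := wE j.
  have -> : complex.Re (z * w 0 j) = complex.Re z * complex.Re (w 0 j)
      - complex.Im z * complex.Im (w 0 j) by case: z {wz wE} (w 0 j) => ? ? [].
  move=> <-; rewrite raddf_sum; apply: eq_bigr => i _.
  by rewrite mxE; case: (w 0 i) => c d /=; rewrite mulr0 subr0.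
have vE : v *m A = complex.Re z *: v + complex.Im z *: u.
  apply/rowP => j; rewrite !mxE.
  have /(congr1 (@complex.Im R)) := wE j.
  have -> : complex.Im (z * w 0 j) = complex.Re z * complex.Im (w 0 j)
      + complex.Im z * complex.Re (w 0 j) by case: z {wz wE uE} (w 0 j) => ? ? [].
  move=> <-; rewrite raddf_sum; apply: eq_bigr => i _.
  by rewrite mxE; case: (w 0 i) => c d /=; rewrite mulr0 add0r.
pose q (x y : 'rV[R]_n.+1) := (x *m y^T) 0 0.
have qC x y : q x y = q y x.
  by rewrite /q -[in LHS](trmxK (x *m y^T)) trmx_mul trmxK mxE.
have qA : q (u *m A) v = q (v *m A) u.
  by rewrite qC /q trmx_mul symA mulmxA.
have q_ge0 x : 0 <= q x x.
  by rewrite /q mxE; apply: sumr_ge0 => i _; rewrite mxE -expr2 sqr_ge0.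
have q_eq0 x : q x x = 0 -> x = 0.
  rewrite /q mxE => /eqP; rewrite psumr_eq0; last first.
    by move=> i _; rewrite mxE -expr2 sqr_ge0.
  move=> /allP x0; apply/rowP => i; move: (x0 i (mem_index_enum _)).
  by rewrite mxE -expr2 sqrf_eq0 mxE => /eqP.
have zim : complex.Im z = 0.
  move: qA; rewrite uE vE /q mulmxBl mulmxDl -!scalemxAl.
  rewrite [in LHS]mxE [in LHS]mxE [X in _ + X]mxE [X in _ - X]mxE.
  rewrite [in RHS]mxE [in RHS]mxE [X in _ = _ + X]mxE -/(q u v) -/(q v v) -/(q v u) -/(q u u).
  rewrite (qC v u) => h.
  have {h} : complex.Im z * (q u u + q v v) = 0 by lra.
  move/eqP; rewrite mulf_eq0 => /orP [/eqP //|].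
  rewrite paddr_eq0 // => /andP [/eqP/q_eq0 u0 /eqP/q_eq0 v0].
  case/negP: w0; apply/eqP/rowP => j; rewrite mxE.
  have := congr1 (fun M => fun_of_matrix M 0 j) u0.
  have := congr1 (fun M => fun_of_matrix M 0 j) v0.
  by rewrite !mxE; case: (w 0 j) => a b /= -> ->.
have [u0|u0] := eqVneq u 0.
  exists (complex.Re z), v^T; split; last first.
    by rewrite -{1}symA -trmx_mul vE zim scale0r addr0 linearZ.
  apply: contra w0 => /eqP v0; apply/eqP/rowP => j; rewrite mxE.
  have := congr1 (fun M => fun_of_matrix M 0 j) u0.
  have := congr1 (fun M => fun_of_matrix M j 0) v0.
  by rewrite !mxE; case: (w 0 j) => a b /= -> ->.
exists (complex.Re z), u^T; split.
  by apply: contra u0 => /eqP v0; rewrite -(trmxK u) v0 trmx0.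
by rewrite -{1}symA -trmx_mul uE zim scale0r subr0 linearZ.
Qed.

(** A Householder reflection: with [w = v - e], the matrix [1 - 2 w w^T / |w|^2] is orthogonal and
    sends the first basis vector [e] to [v]. Here [|w|^2 = 2 - 2 t], nonzero once [v] differs from
    [e]. *)
Lemma unit_vector_first_col (R : realFieldType) n (v : 'cV[R]_n.+1) :
  v^T *m v = 1%:M -> exists V : 'M[R]_n.+1, V^T *m V = 1%:M /\ col 0 V = v.
Proof.
pose e : 'cV[R]_n.+1 := delta_mx 0 0.
have ee : e^T *m e = 1%:M.
  by rewrite /e trmx_delta mul_delta_mx; apply/matrixP => i j; rewrite !ord1 !mxE.
move=> vv; have [->|ve] := eqVneq v e.
  by exists 1%:M; rewrite trmx1 mul1mx colE mul1mx.
pose w := v - e; pose t := (v^T *m e) 0 0.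
have ve_t : v^T *m e = t%:M by rewrite [LHS]mx11_scalar.
have ev_t : e^T *m v = t%:M.
  by rewrite -(trmxK (e^T *m v)) trmx_mul trmxK ve_t tr_scalar_mx.
have wTE : w^T = v^T - e^T by rewrite /w raddfB.
have ww : w^T *m w = (2 - 2 * t)%:M.
  rewrite wTE /w mulmxBl !mulmxBr vv ee ve_t ev_t.
  by rewrite -!raddfB /=; congr (_%:M); ring.
have t1 : 2 - 2 * t != 0.
  apply: contra ve => /eqP t0; rewrite -subr_eq0 -/w; apply/eqP/colP => i.
  have /eqP : \sum_j w^T 0 j * w j 0 = 0.
    by have := congr1 (fun M => fun_of_matrix M 0 0) ww; rewrite t0 mxE => ->; rewrite !mxE mul0rn.
  rewrite psumr_eq0; last by move=> j _; rewrite [w^T _ _]mxE -expr2 sqr_ge0.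
  move=> /allP /(_ i (mem_index_enum _)).
  by rewrite [w^T _ _]mxE -expr2 sqrf_eq0 [RHS]mxE => /eqP.
pose c := 2 / (2 - 2 * t).
pose V := 1%:M - c *: (w *m w^T).
have symV : V^T = V.
  by rewrite /V raddfB /= trmx1 linearZ /= trmx_mul trmxK.
exists V; split.
  have PP : w *m w^T *m (w *m w^T) = (2 - 2 * t) *: (w *m w^T).
    by rewrite mulmxA -(mulmxA w) ww mul_mx_scalar -scalemxAl.
  rewrite symV /V mulmxBl mul1mx mulmxBr mulmx1 -scalemxAl -scalemxAr PP !scalerA.
  rewrite -scalerBl -addrA -opprD -scalerDl [X in X *: _](_ : _ = 0) ?scale0r ?subr0 //.
  by rewrite /c; field.
have wTe : w^T *m e = (t - 1)%:M by rewrite wTE mulmxBl ve_t ee -raddfB.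
rewrite colE -/e /V mulmxBl mul1mx -scalemxAl -mulmxA wTe.
rewrite mul_mx_scalar scalerA (_ : c * (t - 1) = -1).
  by rewrite scaleN1r opprK /w addrC subrK.
by rewrite /c; field.
Qed.

(** Induction by deflation: in an orthonormal basis whose first column is a unit eigenvector,
    symmetry makes the matrix block diagonal, and the induction hypothesis diagonalizes the lower
    block. *)
Lemma symmetric_spectral (R : rcfType) n (A : 'M[R]_n) : A^T = A ->
  exists (V : 'M[R]_n) (d : 'rV[R]_n),
    V^T *m V = 1%:M /\ A = V *m diag_mx d *m V^T.
Proof.
elim: n A => [|n IHn] A symA.
  by exists 1%:M, 0; split; apply/matrixP => -[].
have [a [v [v0 Av]]] := symmetric_eigenvector symA.
pose k := (v^T *m v) 0 0.
have k_gt0 : 0 < k.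
  have k_ge0 : 0 <= k.
    by rewrite /k mxE; apply: sumr_ge0 => i _; rewrite mxE -expr2 sqr_ge0.
  rewrite lt_neqAle k_ge0 andbT eq_sym; apply: contra v0.
  rewrite /k mxE psumr_eq0; last by move=> i _; rewrite mxE -expr2 sqr_ge0.
  move=> /allP v0; apply/eqP/colP => i; rewrite [RHS]mxE.
  by have := v0 i (mem_index_enum _); rewrite mxE -expr2 sqrf_eq0 => /eqP.
pose u := (Num.sqrt k)^-1 *: v.
have uu : u^T *m u = 1%:M.
  have -> : u^T = (Num.sqrt k)^-1 *: v^T by rewrite /u linearZ.
  rewrite /u -scalemxAl -scalemxAr scalerA -expr2 exprVn sqr_sqrtr ?ltW //.
  by rewrite [v^T *m v]mx11_scalar -/k scale_scalar_mx mulVf ?gt_eqF.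
have Au : A *m u = a *: u by rewrite /u -scalemxAr Av scalerA mulrC -scalerA.
have [V [VV Vu]] := unit_vector_first_col uu.
pose B := V^T *m A *m V.
have VV' : V *m V^T = 1%:M by rewrite mulmx1C.
have AB : A = V *m B *m V^T.
  by rewrite /B !mulmxA VV' mul1mx -mulmxA VV' mulmx1.
have symB : B^T = B by rewrite /B !trmx_mul trmxK symA mulmxA.
have B0 i : B i 0 = a *+ (i == 0).
  have -> : B i 0 = (col 0 B) i 0 by rewrite [RHS]mxE.
  rewrite colE /B -mulmxA -colE Vu -mulmxA Au -scalemxAr -Vu colE mulmxA VV mul1mx.
  by rewrite !mxE eqxx andbT; case: eqP => _; rewrite ?mulr1 ?mulr0.
have B0' (i j : 'I_n.+1) : j = 0 :> nat -> B i j = a *+ (i == 0%N :> nat).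
  by move=> j0; rewrite (_ : j = 0) ?B0 //; apply: ord_inj.
clearbody B.
pose C := @drsubmx R 1 n 1 n B.
have ul : @ulsubmx R 1 n 1 n B = a%:M.
  by apply/matrixP => i j; rewrite !ord1 !mxE (B0' (@lshift 1 n 0) (@lshift 1 n 0)).
have ur : @ursubmx R 1 n 1 n B = 0.
  apply/matrixP => i j; rewrite !mxE -symB mxE (B0' (rshift 1 j) (@lshift 1 n i)) //=.
  by rewrite ord1.
have dl : @dlsubmx R 1 n 1 n B = 0.
  apply/matrixP => i j; rewrite !mxE (B0' (rshift 1 i) (@lshift 1 n j)) //=.
  by rewrite ord1.
have Bblock : B = block_mx (a%:M : 'M[R]_1) 0 0 C.
  by rewrite -[LHS](@submxK R 1 n 1 n) ul ur dl.
have symC : C^T = C by rewrite /C trmx_drsub symB.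
have [W [d [WW CE]]] := IHn C symC.
pose U : 'M[R]_(1 + n) := block_mx 1%:M 0 0 W.
have UT : U^T = block_mx 1%:M 0 0 W^T by rewrite /U tr_block_mx !trmx0 trmx1.
have UU : U^T *m U = 1%:M.
  rewrite UT /U mulmx_block !mul0mx !mulmx0 !addr0 !add0r mulmx1 WW.
  by rewrite -scalar_mx_block.
have UD : U *m diag_mx (row_mx (a%:M : 'M[R]_1) d) *m U^T = block_mx (a%:M : 'M[R]_1) 0 0 C.
  rewrite diag_mx_row UT /U !mulmx_block CE.
  rewrite !(mul0mx, mulmx0) !(addr0, add0r) !(mul0mx, mul1mx, mulmx1).
  by congr block_mx; apply/matrixP => i j; rewrite !ord1 !mxE.
exists (V *m U), (row_mx (a%:M : 'M[R]_1) d); split.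
  by rewrite trmx_mul mulmxA -(mulmxA _ V^T) VV mulmx1.
by rewrite trmx_mul AB Bblock -UD !mulmxA.
Qed.

(** * Trace inequalities *)

Lemma expr_mx_conj (R : comNzRingType) n (V : 'M[R]_n) (d : 'rV[R]_n) k :
  V^T *m V = 1%:M ->
  (V *m diag_mx d *m V^T) ^+ k = V *m diag_mx (map_mx (fun a => a ^+ k) d) *m V^T.
Proof.
move=> VV; elim: k => [|k IHk].
  rewrite expr0 (_ : map_mx _ d = const_mx 1); last first.
    by apply/rowP => i; rewrite !mxE expr0.
  by rewrite diag_const_mx mulmx1 mulmx1C.
rewrite exprS IHk -[LHS]/(_ *m _) !mulmxA -(mulmxA _ V^T V) VV mulmx1.
rewrite -(mulmxA V) mulmx_diag; congr (_ *m diag_mx _ *m _).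
by apply/rowP => i; rewrite !mxE exprS.
Qed.

(** Over a real field the weights [((V^T W) i j)^2] are nonnegative, so a trace inequality between
    matrices with unrelated eigenbases follows from a scalar one for each pair of eigenvalues. *)
Lemma mxtrace_mul_conj (R : comNzRingType) n (V W : 'M[R]_n) (a b : 'rV[R]_n) :
  \tr (V *m diag_mx a *m V^T *m (W *m diag_mx b *m W^T)) =
  \sum_i \sum_j a 0 i * b 0 j * ((V^T *m W) i j) ^+ 2.
Proof.
rewrite -!mulmxA mxtrace_mulC -!mulmxA; set U := V^T *m W.
rewrite (_ : _ *m _ = diag_mx a *m (U *m diag_mx b) *m U^T); last first.
  by rewrite /U trmx_mul trmxK !mulmxA.
rewrite /mxtrace; apply: eq_bigr => i _; rewrite mxE; apply: eq_bigr => j _.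
by rewrite mul_diag_mx mxE mul_mx_diag mxE [U^T _ _]mxE; ring.
Qed.

Lemma mxtrace_mul_expr_conj (R : comNzRingType) n (V W : 'M[R]_n) (x y : 'rV[R]_n)
  a b : V^T *m V = 1%:M -> W^T *m W = 1%:M ->
  \tr ((V *m diag_mx x *m V^T) ^+ a * (W *m diag_mx y *m W^T) ^+ b) =
  \sum_i \sum_j x 0 i ^+ a * y 0 j ^+ b * ((V^T *m W) i j) ^+ 2.
Proof.
move=> VV WW; rewrite !expr_mx_conj // mxtrace_mul_conj.
by apply: eq_bigr => i _; apply: eq_bigr => j _; rewrite !mxE.
Qed.

(** After passing to absolute values, the difference of the two sides is
    [(|x|^a - |y|^a) (|x|^b - |y|^b)], whose factors have the same sign. *)
Lemma ler_pow_cross (R : realDomainType) (x y : R) a b :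
  x ^+ a * y ^+ b + x ^+ b * y ^+ a <= `|x| ^+ (a + b) + `|y| ^+ (a + b).
Proof.
apply: (@le_trans _ _ (`|x| ^+ a * `|y| ^+ b + `|x| ^+ b * `|y| ^+ a)).
  by apply: lerD; rewrite -!normrX -normrM ler_norm.
rewrite -subr_ge0 !exprD.
have -> : `|x| ^+ a * `|x| ^+ b + `|y| ^+ a * `|y| ^+ b -
  (`|x| ^+ a * `|y| ^+ b + `|x| ^+ b * `|y| ^+ a)
  = (`|x| ^+ a - `|y| ^+ a) * (`|x| ^+ b - `|y| ^+ b) by ring.
have [le_xy|/ltW le_yx] := leP `|x| `|y|.
  by apply: mulr_le0; rewrite subr_le0 lerXn2r // nnegrE.
by apply: mulr_ge0; rewrite subr_ge0 lerXn2r // nnegrE.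
Qed.

(** Factoring out [x - y] leaves the sum of the [x^(2r-i) y^i]. Adding this sum to its reversal
    pairs each term with its mirror image, and [ler_pow_cross] bounds each pair by
    [x^(2r) + y^(2r)]. *)
Lemma ler_odd_pow_diff (R : realFieldType) (x y : R) r :
  (x - y) * (x ^+ r.*2.+1 - y ^+ r.*2.+1) <=
  r.*2.+1%:R / 2 * ((x - y) ^+ 2 * (x ^+ r.*2 + y ^+ r.*2)).
Proof.
rewrite subrXX mulrA -expr2 [leRHS]mulrCA ler_wpM2l ?sqr_ge0 //.
set S := \sum_(i < _) _.
suff : S + S <= r.*2.+1%:R * (x ^+ r.*2 + y ^+ r.*2) by lra.
rewrite {1}/S (reindex_inj rev_ord_inj) /= -big_split /=.
apply: (@le_trans _ _ (\sum_(i < r.*2.+1) (x ^+ r.*2 + y ^+ r.*2))); last first.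
  by rewrite sumr_const card_ord mulr_natl.
apply: ler_sum => i _; rewrite subSS subKn -1?ltnS //.
have eq_even z : `|z| ^+ r.*2 = z ^+ r.*2 :> R.
  by rewrite -muln2 mulnC !exprM -normrX ger0_norm ?sqr_ge0.
have := ler_pow_cross x y i (r.*2 - i).
by rewrite subnKC -1?ltnS // !eq_even.
Qed.

(** In eigenbases of [X] and [Y] both sides are sums over pairs of eigenvalues with the same
    nonnegative weights, compared termwise by [ler_odd_pow_diff]. *)
Lemma mxtrace_odd_pow_diff (R : rcfType) n (X Y : 'M[R]_n) r :
  X^T = X -> Y^T = Y ->
  \tr ((X - Y) * (X ^+ r.*2.+1 - Y ^+ r.*2.+1)) <=
  r.*2.+1%:R / 2 * \tr ((X - Y) ^+ 2 * (X ^+ r.*2 + Y ^+ r.*2)).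
Proof.
move=> /symmetric_spectral [V [x [VV XE]]] /symmetric_spectral [W [y [WW YE]]].
have trC (A B : 'M[R]_n) : \tr (A * B) = \tr (B * A) by exact: mxtrace_mulC.
pose t a b := \tr (X ^+ a * Y ^+ b).
have tE a b : t a b =
    \sum_i \sum_j x 0 i ^+ a * y 0 j ^+ b * ((V^T *m W) i j) ^+ 2.
  by rewrite /t XE YE mxtrace_mul_expr_conj.
(* Cyclicity of the trace brings every noncommutative word to the form [X^a Y^b] covered by [t]. *)
have -> : \tr ((X - Y) * (X ^+ r.*2.+1 - Y ^+ r.*2.+1)) =
    t r.*2.+2 0 - t 1 r.*2.+1 - t r.*2.+1 1 + t 0 r.*2.+2.
  rewrite mulrBl !mulrBr !raddfB /= -!exprS /t !expr1 !expr0 mul1r mulr1.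
  by rewrite (trC Y); ring.
have -> : \tr ((X - Y) ^+ 2 * (X ^+ r.*2 + Y ^+ r.*2)) =
    t r.*2.+2 0 - 2 * t r.*2.+1 1 + t r.*2 2 + t 2 r.*2 - 2 * t 1 r.*2.+1
    + t 0 r.*2.+2.
  have -> : (X - Y) ^+ 2 = X * X - X * Y - Y * X + Y * Y.
    by rewrite expr2 mulrBl !mulrBr opprB addrA addrAC -!addrA [X in _ + X]addrC -!addrA.
  rewrite mulrDr !mulrDl !mulNr !(raddfD, raddfN) /= /t.
  rewrite -(mulrA X Y (X ^+ _)) -(mulrA X X (X ^+ _)) -(mulrA X X (Y ^+ _)).
  rewrite -(mulrA Y X (X ^+ _)) -(mulrA Y Y (X ^+ _)) -(mulrA Y Y (Y ^+ _)).
  rewrite -(mulrA X Y (Y ^+ _)) -(mulrA Y X (Y ^+ _)) -!exprS.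
  have -> : \tr (X * (Y * X ^+ r.*2)) = \tr (X ^+ r.*2.+1 * Y).
    by rewrite trC -mulrA -exprSr trC.
  have -> : \tr (Y * (Y * X ^+ r.*2)) = \tr (X ^+ r.*2 * (Y * Y)).
    by rewrite mulrA trC.
  have -> : \tr (Y * (X * Y ^+ r.*2)) = \tr (X * Y ^+ r.*2.+1).
    by rewrite trC -mulrA -exprSr.
  by rewrite (trC Y (X ^+ _)) !expr2 !expr1 !expr0 !mul1r mulr1; ring.
rewrite !tE !pair_bigA /= !mulr_sumr.
do ?[rewrite -sumrB | rewrite -big_split /=].
rewrite mulr_sumr; apply: ler_sum => -[i j] _ /=.
have := ler_wpM2r (sqr_ge0 ((V^T *m W) i j)) (ler_odd_pow_diff (x 0 i) (y 0 j) r).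
rewrite !exprS !expr0; move: (_ ^+ r.*2) (_ ^+ r.*2) (_%:R / 2) => xr yr c.
by move=> h; apply: le_trans (le_trans h _); rewrite le_eqVlt; apply/orP; left; apply/eqP; ring.
Qed.

(** * Euclidean, operator and Frobenius norms *)

Section EuclideanNorm.
Variable R : realType.

Definition dot p (u v : 'cV[R]_p) : R := (u^T *m v) 0 0.

Lemma dotE p (u v : 'cV[R]_p) : dot u v = \sum_i u i 0 * v i 0.
Proof. by rewrite /dot mxE; apply: eq_bigr => i _; rewrite mxE. Qed.

Lemma dotC p (u v : 'cV[R]_p) : dot u v = dot v u.
Proof. by rewrite !dotE; apply: eq_bigr => i _; rewrite mulrC. Qed.

Lemma dotDl p (u v w : 'cV[R]_p) : dot (u + v) w = dot u w + dot v w.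
Proof. by rewrite !dotE -big_split; apply: eq_bigr => i _; rewrite mxE mulrDl. Qed.

Lemma dotDr p (u v w : 'cV[R]_p) : dot w (u + v) = dot w u + dot w v.
Proof. by rewrite !(dotC w) dotDl. Qed.

Lemma dotZl p c (u v : 'cV[R]_p) : dot (c *: u) v = c * dot u v.
Proof. by rewrite !dotE mulr_sumr; apply: eq_bigr => i _; rewrite mxE mulrA. Qed.

Lemma dotZr p c (u v : 'cV[R]_p) : dot u (c *: v) = c * dot u v.
Proof. by rewrite !(dotC u) dotZl. Qed.

Lemma dotNl p (u v : 'cV[R]_p) : dot (- u) v = - dot u v.
Proof. by rewrite -scaleN1r dotZl mulN1r. Qed.

Lemma dotNr p (u v : 'cV[R]_p) : dot u (- v) = - dot u v.
Proof. by rewrite !(dotC u) dotNl. Qed.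

Lemma dotBl p (u v w : 'cV[R]_p) : dot (u - v) w = dot u w - dot v w.
Proof. by rewrite dotDl dotNl. Qed.

Lemma dotBr p (u v w : 'cV[R]_p) : dot w (u - v) = dot w u - dot w v.
Proof. by rewrite dotDr dotNr. Qed.

Lemma dot_mulmxl p q (A : 'M[R]_(p, q)) u v : dot (A *m u) v = dot u (A^T *m v).
Proof. by rewrite /dot trmx_mul mulmxA. Qed.

Lemma sqr_enorm p (v : 'cV[R]_p) : enorm v ^+ 2 = dot v v.
Proof.
rewrite /enorm sqr_sqrtr ?dotE; first by apply: eq_bigr => i _; rewrite expr2.
by rewrite sumr_ge0 // => i _; exact: sqr_ge0.
Qed.

Lemma enorm_ge0 p (v : 'cV[R]_p) : 0 <= enorm v.
Proof. exact: sqrtr_ge0. Qed.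

Lemma enorm_le p q (u : 'cV[R]_p) (v : 'cV[R]_q) (c : R) : 0 <= c ->
  (enorm u <= c * enorm v) = (dot u u <= c ^+ 2 * dot v v).
Proof.
move=> c0; rewrite -!sqr_enorm -exprMn ler_pXn2r // nnegrE ?enorm_ge0 //.
by rewrite mulr_ge0 ?enorm_ge0.
Qed.

Lemma enorm_eq0 p (v : 'cV[R]_p) : enorm v = 0 -> v = 0.
Proof.
move=> v0; have := sqr_enorm v; rewrite v0 expr0n dotE /= => /esym/eqP.
rewrite psumr_eq0 => [/allP h|i _]; last by rewrite -expr2 sqr_ge0.
apply/colP => i; have := h i (mem_index_enum _).
by rewrite -expr2 sqrf_eq0 mxE => /eqP.
Qed.

Lemma enormZ p c (v : 'cV[R]_p) : enorm (c *: v) = `|c| * enorm v.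
Proof.
rewrite /enorm -sqrtr_sqr -sqrtrM ?sqr_ge0 //; congr Num.sqrt.
by rewrite mulr_sumr; apply: eq_bigr => i _; rewrite mxE exprMn.
Qed.

Lemma enorm0 p : enorm (0 : 'cV[R]_p) = 0.
Proof. by rewrite -(scale0r 0) enormZ normr0 mul0r. Qed.

(** Cauchy-Schwarz from Lagrange's identity: the sum of the squares of the 2 by 2 minors is
    nonnegative. *)
Lemma dot_le p (u v : 'cV[R]_p) : `|dot u v| <= enorm u * enorm v.
Proof.
rewrite -(@ler_pXn2r _ 2) ?nnegrE ?mulr_ge0 ?enorm_ge0 //.
rewrite exprMn real_normK ?num_real // !sqr_enorm !dotE.
set a := \sum_i _; set b := \sum_i _; set c := \sum_i _.
have : 0 <= \sum_i \sum_j (u i 0 * v j 0 - u j 0 * v i 0) ^+ 2.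
  by apply: sumr_ge0 => i _; apply: sumr_ge0 => j _; apply: sqr_ge0.
have -> : \sum_i \sum_j (u i 0 * v j 0 - u j 0 * v i 0) ^+ 2 =
    b * c - 2 * (a * a) + c * b.
  rewrite /a /b /c !big_distrlr /= mulr_sumr -sumrB -big_split /=.
  apply: eq_bigr => i _; rewrite mulr_sumr -sumrB -big_split /=.
  by apply: eq_bigr => j _; ring.
by rewrite expr2; lra.
Qed.

Lemma enormD p (u v : 'cV[R]_p) : enorm (u + v) <= enorm u + enorm v.
Proof.
rewrite -(@ler_pXn2r _ 2) ?nnegrE ?addr_ge0 ?enorm_ge0 //.
rewrite sqrrD !sqr_enorm dotDl !dotDr (dotC v u).
by have := le_trans (ler_norm _) (dot_le u v); lra.
Qed.

Lemma enorm_sum p (I : finType) (F : I -> 'cV[R]_p) :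
  enorm (\sum_i F i) <= \sum_i enorm (F i).
Proof.
elim/big_ind2: _ => [|x a y b xa yb|//]; first by rewrite enorm0.
exact: le_trans (enormD _ _) (lerD xa yb).
Qed.

(** Operator-norm bounds are kept as a predicate, so that they add and scale without handling the
    supremum in [specnorm]. *)
Definition opbound p q (A : 'M[R]_(p, q)) (K : R) :=
  forall v, enorm (A *m v) <= K * enorm v.

Lemma opbound_dot p (A : 'M[R]_p) K u v : opbound A K ->
  dot u (A *m v) <= K * enorm u * enorm v.
Proof.
move=> AK; apply: le_trans (ler_norm _) (le_trans (dot_le _ _) _).
by rewrite (mulrC K) -mulrA ler_wpM2l ?enorm_ge0.
Qed.

Lemma opboundD p (A B : 'M[R]_p) a b :
  opbound A a -> opbound B b -> opbound (A + B) (a + b).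
Proof.
move=> Aa Bb v; rewrite mulmxDl mulrDl.
exact: le_trans (enormD _ _) (lerD (Aa v) (Bb v)).
Qed.

Lemma opboundZ p (A : 'M[R]_p) a c : opbound A a -> opbound (c *: A) (`|c| * a).
Proof. by move=> Aa v; rewrite -scalemxAl enormZ -mulrA ler_wpM2l. Qed.

Lemma opboundN p (A : 'M[R]_p) a : opbound A a -> opbound (- A) a.
Proof. by move=> Aa v; rewrite mulNmx -scaleN1r enormZ normrN1 mul1r; exact: Aa. Qed.

Lemma opbound_mean p m (A : 'I_m -> 'M[R]_p) a : (0 < m)%N ->
  (forall i, opbound (A i) a) -> opbound (m%:R^-1 *: \sum_i A i) a.
Proof.
move=> m0 Aa.
have S : opbound (\sum_i A i) (m%:R * a).
  move=> v; rewrite mulmx_suml; apply: le_trans (enorm_sum _) _.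
  apply: (@le_trans _ _ (\sum_(i < m) a * enorm v)); first by apply: ler_sum => i _; exact: Aa.
  by rewrite sumr_const card_ord -mulrA mulr_natl.
have := opboundZ m%:R^-1 S.
by rewrite ger0_norm ?invr_ge0 // mulrA mulVf ?mul1r // pnatr_eq0 -lt0n.
Qed.

Definition frob2 p q (A : 'M[R]_(p, q)) : R := \tr (A^T *m A).

Lemma frob2E p q (A : 'M[R]_(p, q)) : frob2 A = \sum_j enorm (col j A) ^+ 2.
Proof.
rewrite /frob2 /mxtrace; apply: eq_bigr => j _.
by rewrite sqr_enorm dotE mxE; apply: eq_bigr => i _; rewrite !mxE.
Qed.

Lemma frob2_ge0 p q (A : 'M[R]_(p, q)) : 0 <= frob2 A.
Proof. by rewrite frob2E; apply: sumr_ge0 => j _; exact: sqr_ge0. Qed.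

Lemma opbound_frob p (A : 'M[R]_p) : opbound A (Num.sqrt (frob2 A)).
Proof.
move=> v; rewrite enorm_le ?sqrtr_ge0 // sqr_sqrtr ?frob2_ge0 //.
have -> : frob2 A = \sum_i enorm (row i A)^T ^+ 2.
  rewrite /frob2 mxtrace_mulC /mxtrace; apply: eq_bigr => j _.
  by rewrite sqr_enorm dotE mxE; apply: eq_bigr => i _; rewrite !mxE.
rewrite dotE mulr_suml; apply: ler_sum => i _; rewrite -sqr_enorm -exprMn -expr2.
have -> : (A *m v) i 0 = dot (row i A)^T v.
  by rewrite dotE mxE; apply: eq_bigr => j _; rewrite !mxE.
by rewrite -real_normK ?num_real // ler_pXn2r ?nnegrE ?mulr_ge0 ?enorm_ge0 ?dot_le.
Qed.

Lemma frob2_mulmx_le p q (A : 'M[R]_p) (B : 'M[R]_(p, q)) K : 0 <= K ->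
  opbound A K -> frob2 (A *m B) <= K ^+ 2 * frob2 B.
Proof.
move=> K0 AK; rewrite !frob2E mulr_sumr; apply: ler_sum => j _.
rewrite -exprMn ler_pXn2r ?nnegrE ?mulr_ge0 ?enorm_ge0 //.
by rewrite !colE -mulmxA -colE; exact: AK.
Qed.

(** The identity has squared Frobenius norm [p]: the factor [sqrt p] of the quadratic term
    originates here. *)
Lemma frob2_le p (A : 'M[R]_p) K : 0 <= K -> opbound A K -> frob2 A <= p%:R * K ^+ 2.
Proof.
move=> K0 AK; rewrite -[A]mulmx1; apply: le_trans (frob2_mulmx_le _ K0 AK) _.
by rewrite /frob2 trmx1 mulmx1 mxtrace1 mulrC.
Qed.

(** The Frobenius norm bounds the set whose supremum is taken, so [sup] is a genuine upper bound; a
    nonzero [v] is then normalized. *)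
Lemma opbound_specnorm p (A : 'M[R]_p) : opbound A (specnorm A).
Proof.
move=> v; have [v0|v0] := eqVneq (enorm v) 0.
  by rewrite (enorm_eq0 v0) mulmx0 !enorm0 mulr0.
have v_gt0 : 0 < enorm v by rewrite lt_neqAle eq_sym v0 enorm_ge0.
rewrite -ler_pdivrMr // mulrC -[X in X * _]ger0_norm ?invr_ge0 ?enorm_ge0 //.
rewrite -enormZ scalemxAr; apply: ub_le_sup.
  exists (Num.sqrt (frob2 A)) => _ [x x1 <-].
  apply: le_trans (opbound_frob A x) _.
  by rewrite ler_piMr ?sqrtr_ge0.
by exists ((enorm v)^-1 *: v) => //=; rewrite enormZ ger0_norm ?invr_ge0 ?enorm_ge0 ?mulVf.
Qed.

Lemma opbound_le p (A : 'M[R]_p) a b : a <= b -> opbound A a -> opbound A b.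
Proof. by move=> ab Aa v; apply: le_trans (Aa v) _; rewrite ler_wpM2r ?enorm_ge0. Qed.

End EuclideanNorm.

(** * Quadratic forms and norms of orthogonally diagonalized matrices *)

Section OrthogonalConjugation.
Variables (R : realType) (p : nat).
Implicit Types (V W A : 'M[R]_p) (d : 'rV[R]_p) (v : 'cV[R]_p).

Lemma tr_conj_diag V d : (V *m diag_mx d *m V^T)^T = V *m diag_mx d *m V^T.
Proof. by rewrite !trmx_mul trmxK tr_diag_mx mulmxA. Qed.

Lemma dot_trmx_conj V v : V^T *m V = 1%:M -> dot (V^T *m v) (V^T *m v) = dot v v.
Proof. by move=> VV; rewrite dot_mulmxl trmxK mulmxA mulmx1C // mul1mx. Qed.

Lemma dot_conj_diag V d v : dot v (V *m diag_mx d *m V^T *m v) =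
  \sum_i d 0 i * ((V^T *m v) i 0) ^+ 2.
Proof.
rewrite -!mulmxA dotC dot_mulmxl dotE; apply: eq_bigr => i _.
by rewrite mul_diag_mx mxE; ring.
Qed.

Lemma opbound_conj_diag V d K : V^T *m V = 1%:M -> 0 <= K ->
  (forall i, `|d 0 i| <= K) -> opbound (V *m diag_mx d *m V^T) K.
Proof.
move=> VV K0 dK v; rewrite enorm_le // dot_mulmxl tr_conj_diag mulmxA.
rewrite -[_ *m _ *m (V *m _ *m _)]/(_ * _) -expr2 expr_mx_conj // dot_conj_diag.
rewrite -(dot_trmx_conj v VV) dotE mulr_sumr; apply: ler_sum => i _.
rewrite mxE -expr2 ler_wpM2r ?sqr_ge0 // -real_normK ?num_real //.
by rewrite ler_pXn2r ?nnegrE.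
Qed.

Lemma dot_conj_diag_ge V d k v : V^T *m V = 1%:M -> (forall i, k <= d 0 i) ->
  k * dot v v <= dot v (V *m diag_mx d *m V^T *m v).
Proof.
move=> VV dk; rewrite dot_conj_diag -(dot_trmx_conj v VV) dotE mulr_sumr.
by apply: ler_sum => i _; rewrite -expr2 ler_wpM2r ?sqr_ge0.
Qed.

Lemma conj_diag_ge V d k : V^T *m V = 1%:M ->
  (forall v, k * dot v v <= dot v (V *m diag_mx d *m V^T *m v)) ->
  forall i, k <= d 0 i.
Proof.
move=> VV kA i; have := kA (col i V).
have VVi : V^T *m col i V = delta_mx i 0 by rewrite colE mulmxA VV mul1mx.
rewrite -(dot_trmx_conj _ VV) dot_conj_diag VVi dotE.
rewrite (bigD1 i) //= big1 => [|j ji]; last by rewrite !mxE (negbTE ji) mulr0.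
rewrite (bigD1 i) //= big1 => [|j ji]; last first.
  by rewrite !mxE (negbTE ji) expr0n mulr0.
by rewrite !mxE !eqxx /= expr1n !mulr1 !addr0 mulr1.
Qed.

(** Every diagonal entry of a spectral decomposition is an eigenvalue, hence at least [g]. Since
    [eigenvalue] refers to row vectors, the witness is a row of [V^T]. *)
Lemma lambda_min_dot_ge A g v : A^T = A -> is_lambda_min A g ->
  g * dot v v <= dot v (A *m v).
Proof.
move=> symA [_ gmin]; have [V [d [VV AE]]] := symmetric_spectral symA.
rewrite AE; apply: dot_conj_diag_ge => // i; apply: gmin.
apply/eigenvalueP; exists (row i V^T).
  rewrite AE !mulmxA -(row_mul i V^T) VV -row_mul mul1mx.
  by rewrite row_diag_mx -scalemxAl -rowE.
apply: contraTneq isT => Vi0; have := congr1 (fun M => fun_of_matrix M i i) VV.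
have -> : (V^T *m V) i i = (row i V^T *m col i V) 0 0.
  by rewrite !mxE; apply: eq_bigr => k _; rewrite !mxE.
by rewrite Vi0 mul0mx !mxE eqxx => /eqP; rewrite eq_sym oner_eq0.
Qed.

(** The square expands to [tr (A^2 B^0) - 2 tr (A B) + tr (A^0 B^2)]; keeping the zeroth powers puts
    all three terms on the same weights. *)
Lemma frob2_conj_diag_sub V W a b : V^T *m V = 1%:M -> W^T *m W = 1%:M ->
  frob2 (V *m diag_mx a *m V^T - W *m diag_mx b *m W^T) =
  \sum_i \sum_j (a 0 i - b 0 j) ^+ 2 * ((V^T *m W) i j) ^+ 2.
Proof.
move=> VV WW; set A := V *m _ *m _; set B := W *m _ *m _.
have AT : A^T = A by exact: tr_conj_diag.
have BT : B^T = B by exact: tr_conj_diag.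
pose t k l := \tr (A ^+ k * B ^+ l).
have -> : frob2 (A - B) = t 2 0 - 2 * t 1 1 + t 0 2.
  have DT : (A - B)^T = A - B by rewrite [LHS]raddfB /= AT BT.
  rewrite /frob2 DT mulmxBl !mulmxBr !raddfB /= (mxtrace_mulC B A).
  by rewrite /t !expr2 !expr1 !expr0 mulr1 mul1r -!mulmxE; ring.
rewrite /t !mxtrace_mul_expr_conj // !pair_bigA /= mulr_sumr -sumrB -big_split.
by apply: eq_bigr => -[i j] _ /=; ring.
Qed.

(** Each [(a 0 i - b 0 j)^2] can only shrink under [phi], while the weights depend on [V] and [W]
    alone. The case of interest is truncation from below at [lam]. *)
Lemma frob2_diag_map_sub V W (a b : 'rV[R]_p) (phi : R -> R) :
  V^T *m V = 1%:M -> W^T *m W = 1%:M ->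
  (forall x y, `|phi x - phi y| <= `|x - y|) ->
  frob2 (V *m diag_mx (\row_i phi (a 0 i)) *m V^T -
         W *m diag_mx (\row_i phi (b 0 i)) *m W^T) <=
  frob2 (V *m diag_mx a *m V^T - W *m diag_mx b *m W^T).
Proof.
move=> VV WW phiL; rewrite !frob2_conj_diag_sub //.
apply: ler_sum => i _; apply: ler_sum => j _; rewrite ler_wpM2r ?sqr_ge0 // !mxE.
rewrite -real_normK ?num_real // -[leRHS]real_normK ?num_real //.
by rewrite ler_pXn2r ?nnegrE.
Qed.

Lemma opbound_mxtrace_expr A m t : A^T = A -> (0 < m)%N -> 0 <= t ->
  \tr (A ^+ m.*2) <= t ^+ m.*2 -> opbound A t.
Proof.
move=> symA m0 t0; have [V [d [VV ->]]] := symmetric_spectral symA.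
rewrite expr_mx_conj // mxtrace_mulC mulmxA VV mul1mx mxtrace_diag => trA.
apply: opbound_conj_diag => // i; rewrite -(@ler_pXn2r _ m.*2) ?nnegrE ?double_gt0 //.
apply: le_trans trA; rewrite (bigD1 i) //= mxE -normrX.
have ev x : 0 <= x ^+ m.*2 :> R by rewrite -muln2 exprM sqr_ge0.
by rewrite ger0_norm // lerDl sumr_ge0 // => j _; rewrite mxE.
Qed.

End OrthogonalConjugation.

(** * Concentration of the sub-sampled mean *)

Section MatrixConcentration.
Variables (R : realType) (p n s : nat) (A : 'I_n -> 'M[R]_p) (K : R).
Hypotheses (n_gt0 : (0 < n)%N) (K_ge0 : 0 <= K).
Hypotheses (symA : forall i, (A i)^T = A i) (A_le : forall i, opbound (A i) K).
Implicit Types (S : {ffun 'I_s -> 'I_n}) (i : 'I_n) (j : 'I_s).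

Let mean : 'M[R]_p := n%:R^-1 *: \sum_i A i.
Let dev S : 'M[R]_p := \sum_j (A (S j) - mean).
Let resample S j i : {ffun 'I_s -> 'I_n} := [ffun k => if k == j then i else S k].

Let mean_sym : mean^T = mean.
Proof.
rewrite /mean linearZ /= raddf_sum /=; congr (_ *: _).
by apply: eq_bigr => i _; exact: symA.
Qed.

Let dev_sym S : (dev S)^T = dev S.
Proof.
rewrite /dev raddf_sum /=; apply: eq_bigr => j _.
by rewrite raddfB /= symA mean_sym.
Qed.

Let dev_resample S j i : dev S - dev (resample S j i) = A (S j) - A i.
Proof.
rewrite /dev -sumrB (bigD1 j) //= big1 => [|k kj]; last first.
  by rewrite ffunE (negbTE kj) subrr.
by rewrite ffunE eqxx addr0 opprB addrA subrK.
Qed.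

(** The map [(S, i) |-> (resample S j i, S j)] is an involution, hence a change of variables. *)
Let sum_resample (G : {ffun 'I_s -> 'I_n} -> 'I_n -> R) j :
  \sum_(S : {ffun 'I_s -> 'I_n}) \sum_i G S i = \sum_(S : {ffun 'I_s -> 'I_n}) \sum_i G (resample S j i) (S j).
Proof.
rewrite !pair_bigA /=.
rewrite (reindex (fun u => (resample u.1 j u.2, u.1 j))) //=.
exists (fun u => (resample u.1 j u.2, u.1 j)) => -[S i] _ /=.
  congr pair; last by rewrite ffunE eqxx.
  by apply/ffunP => k; rewrite !ffunE; case: eqP => [->|].
congr pair; last by rewrite ffunE eqxx.
by apply/ffunP => k; rewrite !ffunE; case: eqP => [->|].
Qed.

Let dev_expr_sym S r : (dev S ^+ r)^T = dev S ^+ r.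
Proof.
have [V [d [VV ->]]] := symmetric_spectral (dev_sym S).
by rewrite expr_mx_conj // tr_conj_diag.
Qed.

(** Splitting the even power as [P^T P] turns the trace into the squared Frobenius norm of
    [(A i1 - A i2) P], whose first factor has operator norm at most [2 K]. *)
Let mxtrace_diff_le S i1 i2 r :
  \tr ((A i1 - A i2) ^+ 2 * dev S ^+ r.*2) <= (2 * K) ^+ 2 * \tr (dev S ^+ r.*2).
Proof.
set B := A i1 - A i2; set P := dev S ^+ r.
have PT : P^T = P by exact: dev_expr_sym.
have BT : B^T = B by rewrite /B raddfB /= !symA.
have -> : dev S ^+ r.*2 = P^T * P by rewrite PT -addnn exprD.
have -> : \tr (B ^+ 2 * (P^T * P)) = frob2 (B *m P).
  have -> : frob2 (B *m P) = \tr (P * (B * (B * P))).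
    by rewrite /frob2 trmx_mul PT BT -mulmxA.
  by rewrite PT [RHS]mxtrace_mulC -!mulmxE expr2 -!mulmxE -!mulmxA.
apply: frob2_mulmx_le; first by rewrite mulr_ge0.
have -> : 2 * K = K + K by ring.
by apply: opboundD => //; apply: opboundN.
Qed.

(* Exchangeable pairs: replacing the [j]-th draw by an independent one swaps the
   roles of [S j] and [i], which symmetrizes the sum. *)
Let moment_coord j r :
  \sum_(S : {ffun 'I_s -> 'I_n}) \sum_i \tr ((A (S j) - A i) * dev S ^+ r.*2.+1) <=
  r.*2.+1%:R * (2 * K ^+ 2) * (n%:R * \sum_(S : {ffun 'I_s -> 'I_n}) \tr (dev S ^+ r.*2)).
Proof.
set G := \sum_(S : {ffun 'I_s -> 'I_n}) _.
suff : G + G <= 2 * (r.*2.+1%:R * (2 * K ^+ 2) * (n%:R * \sum_(S : {ffun 'I_s -> 'I_n}) \tr (dev S ^+ r.*2))) by lra.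
rewrite [X in X + _](_ : G = \sum_(S : {ffun 'I_s -> 'I_n}) \sum_i \tr ((A (S j) - A i) * dev S ^+ r.*2.+1)) //.
rewrite [X in _ + X](_ : G = \sum_(S : {ffun 'I_s -> 'I_n}) \sum_i
    \tr ((A i - A (S j)) * dev (resample S j i) ^+ r.*2.+1)); last first.
  rewrite /G (sum_resample _ j); apply: eq_bigr => S _; apply: eq_bigr => i _.
  by rewrite ffunE eqxx.
rewrite -big_split /=.
under eq_bigr do rewrite -big_split /=.
pose B := r.*2.+1%:R / 2 * (2 * K) ^+ 2.
pose T S := \tr (dev S ^+ r.*2).
apply: (@le_trans _ _ (\sum_(S : {ffun 'I_s -> 'I_n}) \sum_i (B * T S + B * T (resample S j i)))).
  apply: ler_sum => S _; apply: ler_sum => i _.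
  have -> : \tr ((A (S j) - A i) * dev S ^+ r.*2.+1) +
      \tr ((A i - A (S j)) * dev (resample S j i) ^+ r.*2.+1) =
      \tr ((dev S - dev (resample S j i)) *
           (dev S ^+ r.*2.+1 - dev (resample S j i) ^+ r.*2.+1)).
    by rewrite dev_resample mulrBr raddfB /= -[A i - _]opprB mulNr raddfN.
  apply: le_trans (mxtrace_odd_pow_diff _ _ _) _; [exact: dev_sym..|].
  rewrite dev_resample -mulrDr /B -[leRHS]mulrA ler_wpM2l ?divr_ge0 //.
  by rewrite !mulrDr raddfD; apply: lerD; exact: mxtrace_diff_le.
have -> : \sum_(S : {ffun 'I_s -> 'I_n}) \sum_i (B * T S + B * T (resample S j i)) =
    2 * \sum_(S : {ffun 'I_s -> 'I_n}) \sum_(i < n) B * T S.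
  rewrite mulr2n mulrDl mul1r {2}(sum_resample (fun S _ => B * T S) j) -big_split /=.
  by apply: eq_bigr => S _; rewrite big_split.
have -> : \sum_(S : {ffun 'I_s -> 'I_n}) \sum_(i < n) B * T S =
    n%:R * (B * \sum_(S : {ffun 'I_s -> 'I_n}) T S).
  by rewrite !mulr_sumr; apply: eq_bigr => S _; rewrite sumr_const card_ord mulr_natl.
by rewrite /B le_eqVlt; apply/orP; left; apply/eqP; field.
Qed.

(** One factor of the power is expanded: [A (S j) - mean] is the average over [i] of
    [A (S j) - A i]. Each of the [s] coordinates is then handled by [moment_coord]. *)
Let moment_step r :
  \sum_(S : {ffun 'I_s -> 'I_n}) \tr (dev S ^+ r.+1.*2) <=
  r.*2.+1%:R * (2 * s%:R * K ^+ 2) * \sum_(S : {ffun 'I_s -> 'I_n}) \tr (dev S ^+ r.*2).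
Proof.
have n0 : n%:R != 0 :> R by rewrite pnatr_eq0 -lt0n.
have -> : \sum_(S : {ffun 'I_s -> 'I_n}) \tr (dev S ^+ r.+1.*2) = n%:R^-1 *
    \sum_j \sum_(S : {ffun 'I_s -> 'I_n}) \sum_i \tr ((A (S j) - A i) * dev S ^+ r.*2.+1).
  rewrite [in RHS]exchange_big mulr_sumr; apply: eq_bigr => S _ /=.
  rewrite doubleS exprS {1}/dev mulr_suml raddf_sum /= mulr_sumr.
  apply: eq_bigr => j _; rewrite -raddf_sum -mulr_suml -linearZ /= scalemxAl.
  congr (\tr (_ * _)); rewrite sumrB sumr_const card_ord scalerBr -[A _ *+ n]scaler_nat.
  by rewrite scalerA mulVf // scale1r.
apply: (@le_trans _ _ (n%:R^-1 * \sum_(j < s)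
    (r.*2.+1%:R * (2 * K ^+ 2) * (n%:R * \sum_(S : {ffun 'I_s -> 'I_n}) \tr (dev S ^+ r.*2))))).
  by rewrite ler_wpM2l ?invr_ge0 //; apply: ler_sum => j _; exact: moment_coord.
rewrite sumr_const card_ord -mulr_natl le_eqVlt; apply/orP; left; apply/eqP.
by field.
Qed.

(** Iterates [moment_step]; the product is the double factorial [(2m-1)!!], and the zeroth moment is
    the trace [p] of the identity for each of the [n^s] draws. *)
Let moment_le m :
  \sum_(S : {ffun 'I_s -> 'I_n}) \tr (dev S ^+ m.*2) <=
  (\prod_(i < m) i.*2.+1)%:R * (2 * s%:R * K ^+ 2) ^+ m * (p%:R * (n ^ s)%:R).
Proof.
elim: m => [|m IHm].
  rewrite big_ord0 expr0 !mul1r.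
  under eq_bigr do rewrite expr0 mxtrace1.
  by rewrite sumr_const card_ffun !card_ord mulr_natr.
apply: le_trans (moment_step m) _.
have c0 : 0 <= m.*2.+1%:R * (2 * s%:R * K ^+ 2) by rewrite !mulr_ge0 ?sqr_ge0.
apply: le_trans (ler_wpM2l c0 IHm) _.
rewrite big_ord_recr /= natrM; set c := 2 * _ * _.
by rewrite [c ^+ m.+1]exprS le_eqVlt; apply/orP; left; apply/eqP; ring.
Qed.

(** Markov's inequality as a count: a bad draw has [tr (dev S ^ (2m))] at least [(s t)^(2m)], and
    all the other traces are nonnegative. *)
Lemma card_opbound_dev_gt m t : (0 < m)%N -> (0 < s)%N -> 0 <= t ->
  #|[pred S : {ffun 'I_s -> 'I_n} |
      `[< ~ opbound (s%:R^-1 *: \sum_j A (S j) - n%:R^-1 *: \sum_i A i) t >]]|%:R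
    * (s%:R * t) ^+ m.*2 <=
  (\prod_(i < m) i.*2.+1)%:R * (2 * s%:R * K ^+ 2) ^+ m * (p%:R * (n ^ s)%:R).
Proof.
move=> m0 s0 t0; have sR : 0 < s%:R :> R by rewrite ltr0n.
apply: le_trans (moment_le m).
rewrite mulr_natl -sumr_const big_mkcond /=; apply: ler_sum => S _.
have tr_ge0 : 0 <= \tr (dev S ^+ m.*2).
  rewrite (_ : _ ^+ _ = (dev S ^+ m)^T *m dev S ^+ m) ?frob2_ge0 //.
  by rewrite dev_expr_sym -addnn exprD.
rewrite inE; case: asboolP => // bad; rewrite leNgt; apply/negP => /ltW small.
apply: bad; have := opbound_mxtrace_expr (dev_sym S) m0 (mulr_ge0 (ltW sR) t0) small.
move=> /(opboundZ s%:R^-1); rewrite ger0_norm ?invr_ge0 ?ltW // mulKf ?gt_eqF //.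
rewrite /dev sumrB sumr_const card_ord scalerBr -[mean *+ s]scaler_nat scalerA.
by rewrite mulVf ?gt_eqF // scale1r.
Qed.

End MatrixConcentration.

(** * Numerical estimates, choice of the moment order, and the resulting tail bound *)

Lemma prod_odd_le m : (\prod_(i < m) i.*2.+1 <= m ^ m)%N.
Proof.
rewrite -(@leq_exp2r _ _ 2) // -expnM mulnC expnM -mulnn.
(* The squared product pairs [2i+1] with its mirror image [2(m-1-i)+1]; they sum to [2m], so their
   product is at most [m^2]. *)
rewrite {1}(reindex_inj rev_ord_inj) /= -big_split /=.
rewrite -[X in (_ <= X ^ m)%N]mulnn -[m in (_ <= _ ^ m)%N]card_ord -prod_nat_const.
apply: leq_prod => i _; rewrite mulnn; have := ltn_ord i.
set k := nat_of_ord i => km.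
rewrite -(@ler_nat int) natrM natrX.
have -> : (m - k.+1).*2.+1%:R = 2 * m%:R - 2 * k%:R - 1 :> int.
  by rewrite -addn1 natrD -muln2 natrM natrB // -[k.+1]addn1 natrD; ring.
have -> : k.*2.+1%:R = 2 * k%:R + 1 :> int by rewrite -addn1 natrD -muln2 natrM; ring.
rewrite -subr_ge0 (_ : _ - _ = (m%:R - (2 * k%:R + 1)) ^+ 2) ?sqr_ge0 //; ring.
Qed.

Lemma card_classical_set (T : finType) (E : T -> Prop) :
  #|[set x | `[< E x >]]| = #|[pred x | `[< E x >]]|.
Proof.
apply: eq_card => x; apply/idP/idP; first exact: set_mem.
exact: mem_set.
Qed.

(** From [1 - 1/8 <= exp (-1/8)] follows [exp (1/8) <= 8/7], and [(8/7)^8 < 3]. *)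
Lemma expR1_le3 (R : realType) : expR (1 : R) <= 3.
Proof.
have h : expR (8^-1 : R) <= 8 / 7.
  have := expR_ge1Dx (- 8^-1 : R); rewrite expRN => h.
  have : 7 / 8 * expR (8^-1 : R) <= 1.
    by rewrite -ler_pdivlMr ?expR_gt0 // mul1r; apply: le_trans h; lra.
  lra.
have -> : (1 : R) = 8%:R * 8^-1 by rewrite divff.
rewrite expRM_natl; apply: (@le_trans _ _ ((8 / 7) ^+ 8)); last by lra.
by rewrite lerXn2r // nnegrE ?expR_ge0 //; lra.
Qed.

(** Fifth powers reduce it to [e^3 <= 27 <= 32 = 2^5]. *)
Lemma ln2_ge (R : realType) : 3 / 5 <= ln (2 : R).
Proof.
rewrite -ler_expR lnK ?posrE // -(@ler_pXn2r _ 5) ?nnegrE ?expR_ge0 //.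
rewrite -expRM_natl (_ : 5%:R * (3 / 5) = 3%:R * 1 :> R); last by field.
rewrite expRM_natl; apply: (@le_trans _ _ (3 ^+ 3)); last by rewrite -!natrX ler_nat.
by rewrite lerXn2r // ?nnegrE ?expR_ge0 ?expR1_le3.
Qed.

(* Optimizing Markov's inequality over the moment: [m] is the integer ceiling of
   [l], where [p * expR (- l) = delta / 2]. *)
Lemma moment_bound_le_delta (R : realType) p (delta : R) :
  (0 < p)%N -> 0 < delta -> delta < 1 -> let l := ln (2 * p%:R / delta) in
  exists m : nat, (0 < m)%N /\ p%:R * (m%:R / (8 * l)) ^+ m <= delta.
Proof.
move=> p0 d0 d1 l.
have pR : 1 <= p%:R :> R by rewrite ler1n.
have q_ge2 : 2 <= 2 * p%:R / delta by rewrite ler_pdivlMr //; nra.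
have q_gt0 : 0 < 2 * p%:R / delta by lra.
(* The value 3/5 is the threshold of [3 (l + 1) <= 8 l], which with [e <= 3] and [m <= l + 1] gives
   [m / (8 l) <= 1 / e] at the end. *)
have l_ge : 3 / 5 <= l.
  by apply: le_trans (ln2_ge R) _; rewrite ler_ln ?posrE.
have l_gt0 : 0 < l by lra.
pose m := `|Num.ceil l|%N.
have mE : m%:R = (Num.ceil l)%:~R :> R.
  by rewrite /m natr_absz ger0_norm // ceil_ge0; lra.
have l_le_m : l <= m%:R by rewrite mE ceil_ge.
have m_le : m%:R <= l + 1.
  by rewrite mE; have := ceilB1_lt l; rewrite intrB; lra.
exists m; split; first by rewrite -(ltr0n R); lra.
have e_gt0 : 0 < expR (1 : R) by exact: expR_gt0.
apply: (@le_trans _ _ (p%:R * expR (- l))); last first.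
  rewrite expRN lnK ?posrE // invf_div (_ : _ * _ = delta / 2); first lra.
  by field; rewrite gt_eqF //; lra.
rewrite ler_wpM2l //; apply: (@le_trans _ _ (expR (-1) ^+ m)); last first.
  by rewrite -expRM_natl ler_expR mulrN1; lra.
rewrite lerXn2r ?nnegrE ?expR_ge0 ?divr_ge0 //; first lra.
rewrite expRN ler_pdivrMr; last by lra.
rewrite mulrC ler_pdivlMr //.
by have := expR1_le3 R; nra.
Qed.

Lemma prob_draw_ge (R : realType) n s (E B : {ffun 'I_s -> 'I_n} -> Prop) (delta : R) :
  (0 < n)%N -> (forall S, ~ B S -> E S) ->
  #|[pred S | `[< B S >]]|%:R <= delta * (n ^ s)%:R ->
  1 - delta <= prob_draw R E.
Proof.
move=> n0 BE cardB.
have N0 : 0 < #|{ffun 'I_s -> 'I_n}|%:R :> R by rewrite card_ffun !card_ord ltr0n expn_gt0 n0.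
rewrite /prob_draw card_classical_set ler_pdivlMr //.
have : #|{ffun 'I_s -> 'I_n}|%:R <=
    #|[pred S | `[< E S >]]|%:R + #|[pred S | `[< B S >]]|%:R :> R.
  rewrite -natrD ler_nat -(cardC [pred S | `[< E S >]]) leq_add2l.
  apply: subset_leq_card; apply/fintype.subsetP => S; rewrite !inE => /asboolPn nE.
  by case: (asboolP (B S)) => // nB; case: nE; exact: BE.
by move: cardB; rewrite card_ffun !card_ord; lra.
Qed.

Lemma mean_concentration (R : realType) p n s (A : 'I_n -> 'M[R]_p) (K t delta : R) :
  (0 < p)%N -> (0 < n)%N -> 0 < delta -> delta < 1 -> 0 < K -> 0 < t ->
  (forall i, (A i)^T = A i) -> (forall i, opbound (A i) K) ->
  16 * K ^+ 2 * ln (2 * p%:R / delta) / t ^+ 2 <= s%:R ->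
  #|[pred S : {ffun 'I_s -> 'I_n} |
      `[< ~ opbound (s%:R^-1 *: \sum_j A (S j) - n%:R^-1 *: \sum_i A i) t >]]|%:R
  <= delta * (n ^ s)%:R.
Proof.
move=> p0 n0 d0 d1 K0 t0 symA AK; set l := ln _ => s_ge.
have [m [m0 pm]] := moment_bound_le_delta p0 d0 d1; rewrite -/l in pm.
have l_gt0 : 0 < l.
  rewrite ln_gt0 // ltr_pdivlMr //.
  have : 1 <= p%:R :> R by rewrite ler1n.
  lra.
have t2 : 0 < t ^+ 2 by rewrite exprn_gt0.
have K2 : 0 < K ^+ 2 by rewrite exprn_gt0.
have s_gt0 : 0 < s%:R :> R.
  by apply: lt_le_trans s_ge; rewrite divr_gt0 // !mulr_gt0.
have s0 : (0 < s)%N by rewrite -(ltr0n R).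
have st_gt0 : 0 < (s%:R * t) ^+ m.*2 by rewrite exprn_gt0 ?mulr_gt0.
rewrite -(ler_pM2r st_gt0).
apply: le_trans (card_opbound_dev_gt n0 (ltW K0) symA AK m0 s0 (ltW t0)) _.
have c0 : 0 <= 2 * s%:R * K ^+ 2 by rewrite !mulr_ge0 ?ltW.
apply: (@le_trans _ _ ((m ^ m)%:R * (2 * s%:R * K ^+ 2) ^+ m * (p%:R * (n ^ s)%:R))).
  by rewrite !ler_wpM2r ?mulr_ge0 ?exprn_ge0 // ler_nat prod_odd_le.
(* The 16 of the sample size is the 2 of the moment bound times the 8 next to [l]: the choice of [m]
   controls the first factor, and the hypothesis on [s] gives [16 s K^2 l <= (s t)^2] for the last
   one. *)
have -> : (m ^ m)%:R * (2 * s%:R * K ^+ 2) ^+ m * (p%:R * (n ^ s)%:R) =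
    p%:R * (m%:R / (8 * l)) ^+ m * (n ^ s)%:R * (16 * s%:R * K ^+ 2 * l) ^+ m.
  have -> : 2 * s%:R * K ^+ 2 = (8 * l)^-1 * (16 * s%:R * K ^+ 2 * l).
    by field; rewrite gt_eqF.
  rewrite natrX !exprMn; ring.
apply: ler_pM.
- by rewrite !mulr_ge0 ?exprn_ge0 ?divr_ge0 // mulr_ge0 // ltW.
- by rewrite exprn_ge0 // !mulr_ge0 ?ltW.
- by rewrite ler_wpM2r.
rewrite -muln2 mulnC exprM; apply: lerXn2r; rewrite ?nnegrE ?sqr_ge0 //.
  by rewrite !mulr_ge0 ?ltW.
have -> : 16 * s%:R * K ^+ 2 * l = s%:R * (16 * K ^+ 2 * l) by ring.
have -> : (s%:R * t) ^+ 2 = s%:R * (s%:R * t ^+ 2) by ring.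
by apply: ler_wpM2l; [exact: ltW | rewrite -ler_pdivrMr].
Qed.

(** * Gradients and Hessians *)

Section GradientHessian.
Variable R : realType.

Lemma differentiable_expansion (V W : normedModType R) (f : V -> W) (a : V) (eps : R) :
  differentiable f a -> 0 < eps ->
  exists2 r : R, 0 < r &
    forall h, `|h| < r -> `|f (a + h) - f a - 'd f a h| <= eps * `|h|.
Proof.
move=> /diff_locallyxC fa e0.
have : \forall h \near (0 : V), `|f (a + h) - f a - 'd f a h| <= eps * `|h|.
  near=> h; rewrite fa -[_ - f a - _]addrA -opprD addrC addKr.
  near: h; exact: (littleoP [littleo of _]).
move=> /nbhs_normP [r /= r0 fr]; exists r => // h hr; apply: fr.
by rewrite /= sub0r normrN.
Unshelve. all: by end_near. Qed.

Lemma is_derive_line (V W : normedModType R) (f : V -> W) (a e : V) (t : R) :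
  differentiable f (a + t *: e) ->
  is_derive t 1 (fun s => f (a + s *: e)) ('d f (a + t *: e) e).
Proof.
move=> df; have dfe : derivable f (a + t *: e) e by exact: diff_derivable.
have quotE : (fun h : R => h^-1 *: ((fun s => f (a + s *: e)) (h *: (1 : R) + t) -
    f (a + t *: e))) =
   (fun h : R => h^-1 *: (f (h *: e + (a + t *: e)) - f (a + t *: e))).
  apply/funext => h; congr (_ *: (f _ - _)).
  by rewrite [h *: 1]mulr1 scalerDl addrCA.
apply: DeriveDef; first by rewrite /derivable /= quotE; exact: dfe.
by rewrite /derive /= quotE -(deriveE _ df).
Qed.

Lemma colE_sum p (v : 'cV[R]_p) : v = \sum_j v j 0 *: evec R j.
Proof.
apply/colP => i; rewrite summxE (bigD1 i) //= big1 => [|j ji].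
  by rewrite !mxE !eqxx mulr1 addr0.
by rewrite !mxE eq_sym (negbTE ji) mulr0.
Qed.

Lemma diff_grad p (f : 'cV[R]_p -> R) x v :
  differentiable f x -> 'd f x v = dot (grad f x) v.
Proof.
move=> df; rewrite {1}[v]colE_sum linear_sum dotE; apply: eq_bigr => j _.
by rewrite linearZ /= mxE deriveE // mulrC.
Qed.

Lemma diff_hess p (f : 'cV[R]_p -> R) x v :
  differentiable (grad f) x -> 'd (grad f) x v = hess f x *m v.
Proof.
move=> df; rewrite {1}[v]colE_sum linear_sum; apply/colP => i.
rewrite summxE mxE; apply: eq_bigr => j _.
by rewrite linearZ /= !mxE deriveE // mulrC.
Qed.

Lemma is_derive_line_grad p (f : 'cV[R]_p -> R) a e (t : R) :
  differentiable f (a + t *: e) ->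
  is_derive t 1 (fun s => f (a + s *: e)) (dot (grad f (a + t *: e)) e).
Proof. by move=> df; rewrite -diff_grad //; exact: is_derive_line. Qed.

Lemma is_derive_dot p (g : R -> 'cV[R]_p) dg u (t : R) :
  is_derive t 1 g dg -> is_derive t 1 (fun s => dot u (g s)) (dot u dg).
Proof.
move=> g'.
have -> : (fun s => dot u (g s)) = \sum_(i < p) (u i 0 *: (fun s => g s i 0)).
  by apply/funext => s; rewrite dotE fct_sumE; apply: eq_bigr.
rewrite dotE; apply: is_derive_sum => i; apply: is_deriveZ.
have [dgt <-] := g'.
have := derivable_mxP g t 1 => -[/(_ dgt) h _].
by rewrite derive_mx // mxE; exact/derivableP.
Qed.

Lemma is_derive_line_hess p (f : 'cV[R]_p -> R) a e u (t : R) :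
  differentiable (grad f) (a + t *: e) ->
  is_derive t 1 (fun s => dot u (grad f (a + s *: e)))
    (dot u (hess f (a + t *: e) *m e)).
Proof.
by move=> df; rewrite -diff_hess //; apply: is_derive_dot; exact: is_derive_line.
Qed.

End GradientHessian.

(** * Symmetry of the Hessian, gradient increments and first-order optimality *)

Section SecondOrder.
Variable R : realType.

Lemma MVT_closed (f df : R -> R) (a b : R) : a < b ->
  (forall x, a <= x <= b -> is_derive x 1 f (df x)) ->
  exists2 c, a < c < b & f b - f a = df c * (b - a).
Proof.
move=> ab fdf; have [] := @MVT R f df a b ab.
- move=> x; rewrite in_itv /= => /andP [ax xb]; apply: fdf.
  by rewrite !ltW.
- apply: derivable_within_continuous => x; rewrite in_itv /= => xab.
  by have [] := fdf x xab.
- by move=> c; rewrite in_itv /= => cab E; exists c.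
Qed.

(** Remainders of differentials are measured in the library norm of matrices, the largest absolute
    entry; hence this mixed bound beside [dot_le]. *)
Lemma dot_le_mx_norm p (u v : 'cV[R]_p) : `|dot u v| <= `|u| * \sum_i `|v i 0|.
Proof.
rewrite dotE mulr_sumr; apply: le_trans (ler_norm_sum _ _ _) _.
apply: ler_sum => i _; rewrite normrM ler_wpM2r //.
rewrite [leRHS]/Num.norm /= mx_normrE.
exact: (le_bigmax _ (fun ij : 'I_p * 'I_1 => `|u ij.1 ij.2|) (i, 0)).
Qed.

(** The mean value theorem for [s |-> f (a + t w + s v) - f (a + s v)] yields a difference of two
    gradients, each expanded to first order at [a]. *)
Lemma second_difference p (f : 'cV[R]_p -> R) (a v w : 'cV[R]_p) (eps : R) :
  (\near a, differentiable f a) -> differentiable (grad f) a -> 0 < eps ->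
  exists2 r : R, 0 < r & forall t, 0 < t < r ->
    `|f (a + t *: v + t *: w) - f (a + t *: v) - f (a + t *: w) + f a
      - t ^+ 2 * dot v (hess f a *m w)| <= eps * t ^+ 2.
Proof.
move=> /nbhs_normP [r1 /= r1_gt0 df] dg eps0.
pose S := \sum_i `|v i 0|; pose C := (`|w| + 2 * `|v|) * S + 1.
have S_ge0 : 0 <= S by apply: sumr_ge0.
have C_gt0 : 0 < C by rewrite /C ltr_wpDl // mulr_ge0 // addr_ge0 // mulr_ge0.
have [r2 r2_gt0 gexp] := differentiable_expansion dg (divr_gt0 eps0 C_gt0).
pose N := `|w| + `|v| + 1; have N_gt0 : 0 < N by rewrite /N ltr_wpDl // addr_ge0.
exists (Num.min r1 r2 / N); first by rewrite divr_gt0 // lt_min r1_gt0.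
move=> t /andP [t0]; rewrite ltr_pdivlMr // lt_min => /andP [tr1 tr2].
have small (s b : R) : 0 <= s <= t -> 0 <= b <= t -> `|b *: w + s *: v| <= t * N.
  move=> /andP [s0 st] /andP [b0 bt]; apply: le_trans (ler_normD _ _) _.
  rewrite !normrZ !ger0_norm // /N !mulrDr mulr1.
  by rewrite -[leLHS]addr0 !lerD ?ler_wpM2r // ltW.
have df' (s b : R) : 0 <= s <= t -> 0 <= b <= t ->
    differentiable f (a + (b *: w + s *: v)).
  move=> hs hb; apply: df; rewrite /= opprD addNKr normrN.
  exact: le_lt_trans (small _ _ hs hb) tr1.
have t_in : 0 <= t <= t by rewrite ltW /=.
have z_in : 0 <= (0 : R) <= t by rewrite lexx ltW.
pose g := (fun s : R => f (a + t *: w + s *: v)) - (fun s : R => f (a + s *: v)).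
pose dg' (s : R) := dot (grad f (a + t *: w + s *: v)) v - dot (grad f (a + s *: v)) v.
have [c /andP [c0 ct] gc] : exists2 c, 0 < c < t & g t - g 0 = dg' c * (t - 0).
  apply: MVT_closed => // s st; apply: is_deriveB.
    by apply: is_derive_line_grad; rewrite -addrA; exact: df'.
  by apply: is_derive_line_grad; rewrite -[s *: v]add0r -(scale0r w); exact: df'.
have c_in : 0 <= c <= t by rewrite !ltW.
have gE : g t - g 0 =
    f (a + t *: v + t *: w) - f (a + t *: v) - f (a + t *: w) + f a.
  rewrite /g /= -![(_ - _ : _ -> _) _]/(_ - _) scale0r !addr0 (addrAC a).
  by rewrite opprB addrA addrAC.
rewrite -gE gc subr0.
pose rho h := grad f (a + h) - grad f a - hess f a *m h.
have rho_le h : `|h| < r2 -> `|rho h| <= eps / C * `|h|.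
  by move=> /gexp; rewrite diff_hess.
have dgE : dg' c = t * dot v (hess f a *m w) + dot (rho (t *: w + c *: v)) v
    - dot (rho (c *: v)) v.
  rewrite /dg' /rho !dotBl -addrA mulmxDr dotDl -!scalemxAr !dotZl.
  by rewrite (dotC v); ring.
have -> : dg' c * t - t ^+ 2 * dot v (hess f a *m w) =
    (dot (rho (t *: w + c *: v)) v - dot (rho (c *: v)) v) * t.
  by rewrite dgE; ring.
rewrite normrM (gtr0_norm t0) expr2 mulrA; apply: ler_wpM2r; first exact: ltW.
apply: le_trans (ler_normB _ _) _.
have cv_le : `|c *: v| <= t * `|v| by rewrite normrZ gtr0_norm // ler_wpM2r // ltW.
have tw_le : `|t *: w + c *: v| <= t * (`|w| + `|v|).
  by apply: le_trans (ler_normD _ _) _; rewrite mulrDr lerD // normrZ gtr0_norm.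
have e_ge0 : 0 <= eps / C by rewrite divr_ge0 ?ltW.
have rho1 : `|rho (t *: w + c *: v)| <= eps / C * (t * (`|w| + `|v|)).
  apply: le_trans (rho_le _ _) _; last by rewrite ler_wpM2l.
  by apply: le_lt_trans tr2; exact: small.
have rho2 : `|rho (c *: v)| <= eps / C * (t * `|v|).
  apply: le_trans (rho_le _ _) _; last by rewrite ler_wpM2l.
  by apply: le_lt_trans tr2; rewrite -[c *: v]add0r -(scale0r w); exact: small.
have d1 := le_trans (dot_le_mx_norm _ v) (ler_wpM2r S_ge0 rho1).
have d2 := le_trans (dot_le_mx_norm _ v) (ler_wpM2r S_ge0 rho2).
apply: le_trans (lerD d1 d2) _.
have -> : eps / C * (t * (`|w| + `|v|)) * S + eps / C * (t * `|v|) * S =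
  eps * t * ((C - 1) / C) by rewrite /C; ring.
rewrite ler_piMr ?mulr_ge0 ?ltW // ltr_pdivrMr //; lra.
Qed.

(** Schwarz's theorem in Young's form: the second difference is symmetric in [v] and [w], and its
    quotient by [t^2] tends to both [B v w] and [B w v]. *)
Lemma hess_sym p (f : 'cV[R]_p -> R) (a : 'cV[R]_p) :
  (\near a, differentiable f a) -> differentiable (grad f) a ->
  (hess f a)^T = hess f a.
Proof.
move=> df dg; pose B v w := dot v (hess f a *m w).
have BC v w : B v w = B w v.
  apply/eqP; rewrite -subr_eq0 -normr_eq0 eq_le normr_ge0 andbT.
  apply/ler_addgt0Pl => e e0; rewrite addr0.
  have e2 : 0 < e / 2 by rewrite divr_gt0.
  have [r r0 h1] := second_difference v w df dg e2.
  have [q q0 h2] := second_difference w v df dg e2.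
  pose t := Num.min r q / 2.
  have t0 : 0 < t by rewrite divr_gt0 // lt_min r0.
  have tm : t < Num.min r q by rewrite ltr_pdivrMr // ltr_pMr ?lt_min ?r0 // ltr1n.
  have tr : 0 < t < r by rewrite t0 (lt_le_trans tm) // ge_min lexx.
  have tq : 0 < t < q by rewrite t0 (lt_le_trans tm) // ge_min lexx orbT.
  have := h1 _ tr; have := h2 _ tq.
  rewrite (addrAC a (t *: w)) -/(B v w) -/(B w v).
  move: (f _) (f _) (f _) (f a) => x1 x2 x3 x4 k1 k2.
  have t2 : 0 < t ^+ 2 by rewrite exprn_gt0.
  rewrite -(ler_pM2r t2) -[X in _ * X <= _](gtr0_norm t2) -normrM.
  have -> : (B v w - B w v) * t ^+ 2 =
      (x3 - x2 - x1 + x4 - t ^+ 2 * B w v) - (x3 - x1 - x2 + x4 - t ^+ 2 * B v w) by ring.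
  apply: le_trans (ler_normB _ _) _.
  have -> : e * t ^+ 2 = e / 2 * t ^+ 2 + e / 2 * t ^+ 2 by field.
  exact: lerD.
have Bentry i j : B (evec R i) (evec R j) = hess f a i j.
  by rewrite /B /evec -colE dotE (bigD1 i) //= big1 => [|k ki];
    rewrite !mxE ?eqxx ?mul1r ?addr0 // (negbTE ki) mul0r.
by apply/matrixP => i j; rewrite mxE -!Bentry BC.
Qed.

(** The mean value theorem is applied to [u . grad f (a + t e) - q t + C t^2 / 2], whose derivative
    is nonnegative on the segment; the quadratic term produces the factor 1/2 without integrating
    the Hessian. *)
Lemma grad_increment_le p (f : 'cV[R]_p -> R) a e u (H : 'M[R]_p) (L : R) :
  (forall t, 0 <= t <= 1 -> differentiable (grad f) (a + t *: e)) ->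
  (forall t, 0 <= t <= 1 -> opbound (hess f (a + t *: e) - H) (L * (t * enorm e))) ->
  dot u (H *m e - (grad f (a + e) - grad f a)) <= L / 2 * enorm e ^+ 2 * enorm u.
Proof.
move=> dg hL; pose C := L * enorm e ^+ 2 * enorm u; pose q := dot u (H *m e).
pose P : {poly R} := (C / 2) *: 'X^2 - q *: 'X.
have P' t : P^`().[t] = C * t - q.
  rewrite /P derivB !derivZ derivXn derivX !hornerE /=.
  by field.
pose psi := (fun t : R => dot u (grad f (a + t *: e))) + horner P.
pose dpsi t := dot u (hess f (a + t *: e) *m e) + P^`().[t].
have [c /andP [c0 c1] E] : exists2 c, 0 < c < 1 & psi 1 - psi 0 = dpsi c * (1 - 0).
  by apply: MVT_closed => // t t01; apply: is_deriveD; exact/is_derive_line_hess/dg.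
have c01 : 0 <= c <= 1 by rewrite !ltW.
have dpsi_ge0 : 0 <= dpsi c.
  have := opbound_dot (- u) e (hL c c01).
  rewrite dotNl mulmxBl dotBr -/q -[- u]scaleN1r enormZ normrN1 mul1r.
  have -> : L * (c * enorm e) * enorm u * enorm e = C * c by rewrite /C; ring.
  by rewrite /dpsi P' opprB lerBlDl addrA subr_ge0.
have P1 : P.[1] = C / 2 - q by rewrite /P !hornerE /=; ring.
have P0 : P.[0] = 0 by rewrite /P !hornerE /=; ring.
have psiE : psi 1 - psi 0 =
    L / 2 * enorm e ^+ 2 * enorm u - dot u (H *m e - (grad f (a + e) - grad f a)).
  have -> : L / 2 * enorm e ^+ 2 * enorm u = C / 2 by rewrite /C; ring.
  rewrite /psi -![(_ + _ : _ -> _) _]/(_ + _) P1 P0 scale1r scale0r !addr0 !dotBr -/q.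
  by ring.
by rewrite -subr_ge0 -psiE E subr0 mulr1.
Qed.

(** For small [t] a negative linear term would outweigh the quadratic one; the [t] chosen satisfies
    [t (|c| + 1) <= - b / 2]. *)
Lemma linear_coef_ge0 (b c : R) :
  (forall t, 0 < t <= 1 -> 0 <= t * b + t ^+ 2 * c) -> 0 <= b.
Proof.
move=> h; rewrite leNgt; apply/negP => b0.
pose t := Num.min 1 (- b / (2 * (`|c| + 1))).
have c1 : 0 < 2 * (`|c| + 1) by rewrite mulr_gt0 // ltr_wpDl.
have t0 : 0 < t by rewrite lt_min ltr01 divr_gt0 // oppr_gt0.
have t1 : t <= 1 by rewrite ge_min lexx.
have tc : t * (2 * (`|c| + 1)) <= - b by rewrite -ler_pdivlMr // ge_min lexx orbT.
have /h : 0 < t <= 1 by rewrite t0.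
have -> : t * b + t ^+ 2 * c = t * (b + t * c) by ring.
rewrite pmulr_rge0 //; have := ler_wpM2l (ltW t0) (ler_norm c).
lra.
Qed.

(** If the slope [d] along [y - a] were negative, a first-order expansion with error at most
    [- t d / 2] would give values below [F a] arbitrarily near [a]. *)
Lemma local_min_grad_ge0 p (F : 'cV[R]_p -> R) (C : set 'cV[R]_p) a y :
  (forall t, 0 <= t <= 1 -> C (a + t *: (y - a))) ->
  local_min_on F C a -> differentiable F a -> 0 <= dot (grad F a) (y - a).
Proof.
move: (y - a) => w segC [_ [r [r0 Fmin]]] dF.
rewrite leNgt; apply/negP; set d := dot _ w => d0.
pose N := `|w| + 1; have N0 : 0 < N by rewrite ltr_wpDl.
pose M := enorm w + 1; have M0 : 0 < M by rewrite ltr_wpDl ?enorm_ge0.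
have eps0 : 0 < - d / (2 * N) by rewrite divr_gt0 ?oppr_gt0 // mulr_gt0.
have [q q0 Fexp] := differentiable_expansion dF eps0.
(* Two radii must be respected: [q] for the expansion, in the entrywise norm, and [r] for the local
   minimum, in the Euclidean norm. *)
pose m := Num.min (q / N) (r / M).
have m0 : 0 < m by rewrite lt_min !divr_gt0.
pose t := Num.min 1 (m / 2).
have t0 : 0 < t by rewrite lt_min ltr01 divr_gt0.
have t1 : t <= 1 by rewrite ge_min lexx.
have tm : t < m.
  by apply: (@le_lt_trans _ _ (m / 2)); [rewrite ge_min lexx orbT | lra].
have tN : t * N < q by rewrite -ltr_pdivlMr // (lt_le_trans tm) // ge_min lexx.
have tM : t * M < r by rewrite -ltr_pdivlMr // (lt_le_trans tm) // ge_min lexx orbT.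
have tw : `|t *: w| <= t * N.
  by rewrite normrZ gtr0_norm // ler_pM2l // lerDl.
have /Fexp := le_lt_trans tw tN; rewrite diff_grad // dotZr -/d => /ler_normlP [_].
have : F a <= F (a + t *: w).
  apply: Fmin; first by apply: segC; rewrite ltW.
  rewrite addrC addKr enormZ gtr0_norm //; apply: le_lt_trans tM.
  by rewrite ler_pM2l // lerDl.
have : - d / (2 * N) * `|t *: w| <= t * (- d / 2).
  apply: (@le_trans _ _ (- d / (2 * N) * (t * N))); first by rewrite ler_wpM2l // ltW.
  by rewrite le_eqVlt; apply/orP; left; apply/eqP; field; rewrite gt_eqF.
have : t * d < 0 by rewrite pmulr_rlt0.
lra.
Qed.

(** Along the segment from [y] to [z] the model changes by [t b + t^2 c], with [b] the product in
    the conclusion and [c] half the form of [M] at [z - y]. *)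
Lemma argmin_qmodel_ge0 p c (xk g : 'cV[R]_p) (M : 'M[R]_p) (C : set 'cV[R]_p) y z :
  M^T = M -> (forall t, 0 <= t <= 1 -> C (y + t *: (z - y))) ->
  is_argmin_on C (qmodel c xk g 1 M) y ->
  0 <= dot (g + M *m (y - xk)) (z - y).
Proof.
move: (z - y) => w symM segC [_ ymin]; apply: (@linear_coef_ge0 _ (2^-1 * dot w (M *m w))).
move=> t /andP [t0 t1]; have /ymin : C (y + t *: w) by apply: segC; rewrite ltW.
rewrite /qmodel -!mulmxA -/(dot _ _) -/(dot _ _) -/(dot _ _) -/(dot _ _) mulr1.
rewrite (addrAC y); move: (y - xk) => x.
rewrite mulmxDr -scalemxAr !dotDl !dotDr !dotZl !dotZr.
have -> : dot x (M *m w) = dot w (M *m x) by rewrite dotC dot_mulmxl symM.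
rewrite (dotC (M *m x) w) (dotC g w).
by rewrite expr2; lra.
Qed.

Lemma convex_set_segment p (C : set 'cV[R]_p) x y t :
  convex_set C -> C x -> C y -> 0 <= t <= 1 -> C (x + t *: (y - x)).
Proof.
move=> cvxC Cx Cy /andP [t0 t1].
have -> : x + t *: (y - x) = t *: y + (1 - t) *: x.
  by rewrite scalerBl scale1r scalerBr addrCA.
exact/set_mem/(cvxC y x (Itv01 t0 t1) (mem_set Cy) (mem_set Cx)).
Qed.

End SecondOrder.

(** * Gradient and Hessian of an average of functions *)

Section FiniteMean.
Variables (R : realType) (p n : nat) (f : 'I_n -> 'cV[R]_p -> R).
Let F := fun x => n%:R^-1 * \sum_(i < n) f i x.

Let FE : F = n%:R^-1 *: (\sum_(i < n) f i).
Proof. by apply/funext => x; rewrite /F fct_sumE. Qed.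

Lemma differentiable_mean x : (forall i, differentiable (f i) x) -> differentiable F x.
Proof. by move=> df; rewrite FE; apply: differentiableZ; exact: differentiable_sum. Qed.

Lemma grad_mean x : (forall i, differentiable (f i) x) ->
  grad F x = n%:R^-1 *: \sum_(i < n) grad (f i) x.
Proof.
move=> df; have dfe i e : derivable (f i) x e by exact: diff_derivable.
apply/colP => j; rewrite !mxE summxE FE deriveZ; last exact: derivable_sum.
rewrite derive_sum //; congr (_ * _).
by apply: eq_bigr => i _; rewrite mxE.
Qed.

Lemma hess_mean x : (\near x, forall i, differentiable (f i) x) ->
  (forall i, differentiable (grad (f i)) x) ->
  hess F x = n%:R^-1 *: \sum_(i < n) hess (f i) x.
Proof.
move=> df dg; have dge i e : derivable (grad (f i)) x e by exact: diff_derivable.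
pose G : 'cV[R]_p -> 'cV[R]_p := n%:R^-1 *: (\sum_(i < n) grad (f i)).
have near_G : \near x, grad F x = G x.
  by apply: filterS df => y dfy; rewrite grad_mean // /G fct_sumE.
apply/matrixP => k j; rewrite !mxE summxE (near_eq_derive _ near_G).
rewrite /G deriveZ; last exact: derivable_sum.
rewrite derive_sum // mxE summxE; congr (_ * _).
by apply: eq_bigr => i _; rewrite mxE.
Qed.

End FiniteMean.

(** * The regularized Newton step *)

Section NewtonStep.
Variables (R : realType) (p : nat).

Lemma ler_dist_maxl (x y l : R) : `|Num.max x l - Num.max y l| <= `|x - y|.
Proof.
by case: (leP x l) => xl; case: (leP y l) => yl; rewrite ?subrr // ler_norml;
  have := ler_norm (x - y); have := ler_norm (- (x - y)); rewrite normrN; lra.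
Qed.

(** The deterministic part: [Hs] stands for the Hessian of [F] at [xstar], [T] and [H] for the
    sub-sampled Hessians at [xstar] and [xk], [D] for [y - xstar], [e] for [xk - xstar], and [G] for
    the gradient increment. *)
Lemma regularized_step_le (Hs T H M : 'M[R]_p) (D e G : 'cV[R]_p) (g eps lam L : R) :
  0 < g -> 0 < eps -> 0 < lam -> 0 < L -> (1 - eps) * g <= lam ->
  T^T = T -> (forall v, g * dot v v <= dot v (Hs *m v)) ->
  opbound (T - Hs) (g * eps) -> opbound (H - T) (L * enorm e) ->
  spectral_reg lam H M ->
  dot D (Hs *m e - G) <= L / 2 * enorm e ^+ 2 * enorm D ->
  dot D (M *m D) <= dot D (M *m e - G) ->
  enorm D <= (lam - (1 - eps) * g + g * eps) / lam * enorm e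
    + (Num.sqrt p%:R + 2^-1) * L / lam * enorm e ^+ 2.
Proof.
move=> g0 eps0 lam0 L0 lam_ge symT Hs_ge T_Hs H_T [V [h [VV [HE ME]]]] DG DM.
have [W [d [WW TE]]] := symmetric_spectral symT.
pose M' := W *m diag_mx (\row_i Num.max (d 0 i) lam) *m W^T.
(* A Weyl-type bound: the form of [Hs] is at least [g], and the perturbation [T - Hs] lowers it by
   at most [g eps]. *)
have d_ge i : (1 - eps) * g <= d 0 i.
  apply: (conj_diag_ge WW) => v; rewrite -TE.
  have := opbound_dot (- v) v T_Hs; rewrite -scaleN1r enormZ normrN1 mul1r scaleN1r.
  rewrite dotNl mulmxBl dotBr -mulrA -expr2 sqr_enorm; have := Hs_ge v.
  by move: (dot v v) (dot v _) (dot v _) => x y z; lra.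
have M'_T : opbound (M' - T) (lam - (1 - eps) * g).
  have -> : M' - T = W *m diag_mx (\row_i Num.max (d 0 i) lam - d) *m W^T.
    by rewrite /M' {1}TE -mulmxBl -mulmxBr -raddfB.
  apply: opbound_conj_diag; rewrite ?subr_ge0 // => i; rewrite !mxE.
  by case: (leP (d 0 i) lam) => dl; rewrite ger0_norm ?subr_ge0 // ?subrr ?subr_ge0 // lerB.
have e_ge0 := enorm_ge0 e; have D_ge0 := enorm_ge0 D.
have Le_ge0 : 0 <= L * enorm e by rewrite mulr_ge0 // ltW.
have M_M' : opbound (M - M') (Num.sqrt p%:R * (L * enorm e)).
  apply: opbound_le (opbound_frob _).
  rewrite -[L * enorm e]ger0_norm // -sqrtr_sqr -sqrtrM // ler_wsqrtr //.
  apply: le_trans (frob2_le Le_ge0 H_T).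
  rewrite ME /M' {1}HE {1}TE; apply: (@frob2_diag_map_sub _ _ V W h d (fun x => Num.max x lam)) => // x y.
  exact: ler_dist_maxl.
have M_ge : lam * dot D D <= dot D (M *m D).
  by rewrite ME; apply: dot_conj_diag_ge => // i; rewrite mxE le_max lexx orbT.
have split_M : M *m e - G =
    (M - M') *m e + (M' - T) *m e + (T - Hs) *m e + (Hs *m e - G).
  by rewrite -!mulmxDl addrA -mulmxDl !addrA !subrK.
move: DM; rewrite split_M 3!dotDr => DM.
have b1 := opbound_dot D e M_M'; have b2 := opbound_dot D e M'_T.
have b3 := opbound_dot D e T_Hs.
have key : lam * enorm D * enorm D <= ((lam - (1 - eps) * g + g * eps) * enorm e
    + (Num.sqrt p%:R + 2^-1) * L * enorm e ^+ 2) * enorm D.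
  apply: le_trans (_ : dot D (M *m D) <= _); first by rewrite -mulrA -expr2 sqr_enorm.
  apply: le_trans DM _; apply: le_trans (lerD (lerD (lerD b1 b2) b3) DG) _.
  by rewrite le_eqVlt; apply/orP; left; apply/eqP; field.
have -> : (lam - (1 - eps) * g + g * eps) / lam * enorm e
    + (Num.sqrt p%:R + 2^-1) * L / lam * enorm e ^+ 2 =
    ((lam - (1 - eps) * g + g * eps) * enorm e
    + (Num.sqrt p%:R + 2^-1) * L * enorm e ^+ 2) / lam by field; rewrite gt_eqF.
rewrite ler_pdivlMr // mulrC.
(* The common factor [|D|] cancels only if it is nonzero; otherwise the right-hand side just has to
   be nonnegative. *)
have [D0|D_neq0] := eqVneq (enorm D) 0.
  rewrite D0 mulr0; apply: addr_ge0.
    by rewrite mulr_ge0 // addr_ge0 ?subr_ge0 // mulr_ge0 // ltW.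
  by rewrite mulr_ge0 ?exprn_ge0 // mulr_ge0 ?(ltW L0) // addr_ge0 ?sqrtr_ge0.
by rewrite -(ler_pM2r (_ : 0 < enorm D)) // lt_neqAle eq_sym D_neq0.
Qed.

End NewtonStep.

(** * Combination of the concentration estimate with the deterministic step bound *)

Unset Implicit Arguments.

Theorem theorem6 (R : realType) (p n : nat)
  (f : 'I_n -> 'cV[R]_p -> R) (dom : 'I_n -> set 'cV[R]_p) (X : set 'cV[R]_p)
  (xstar xk : 'cV[R]_p) (L Kst gst delta eps lam : R) (s : nat) :
  let D := \bigcap_(i in [set: 'I_n]) dom i in
  let F := fun x => (n%:R)^-1 * \sum_(i < n) f i x in
  (0 < p)%N -> (0 < n)%N ->
  open D -> convex_set D -> convex_set X ->
  (forall i, twice_diff_on (dom i) (f i)) ->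
  local_min_on F (D `&` X) xstar ->
  (* (LipS) *)
  0 < L ->
  (forall x i, (D `&` X) x ->
     specnorm (hess (f i) x - hess (f i) xstar) <= L * enorm (x - xstar)) ->
  (* SmS-star *)
  Kst = \big[Num.max/0]_(i < n) specnorm (hess (f i) xstar) ->
  (* SCS-star *)
  is_lambda_min (hess F xstar) gst -> 0 < gst ->
  0 < delta -> delta < 1 -> 0 < eps -> eps < 1 -> 0 < lam ->
  (D `&` X) xk ->
  16 * Kst ^+ 2 * ln (2 * p%:R / delta) / (gst ^+ 2 * eps ^+ 2) <= s%:R ->
  (1 - eps) * gst <= lam ->
  1 - delta <= prob_draw R
    (fun S : {ffun 'I_s -> 'I_n} =>
       forall (M : 'M[R]_p) (y : 'cV[R]_p),
         spectral_reg lam (subH f S xk) M ->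
         is_argmin_on (D `&` X) (qmodel (F xk) xk (grad F xk) 1 M) y ->
         enorm (y - xstar) <=
           (lam - (1 - eps) * gst + gst * eps) / lam * enorm (xk - xstar)
           + (Num.sqrt (p%:R) + 2^-1) * L / lam * enorm (xk - xstar) ^+ 2).

Proof.
move=> D F p0 n0 openD cvxD cvxX df xs_min L0 LipS KE lmin g0 d0 d1 e0 e1 lam0 xkC.
move=> s_ge lam_ge.
have DdomE x : D x -> forall i, dom i x by move=> Dx i; exact: Dx.
have Ddf x : D x -> forall i, differentiable (f i) x.
  by move=> /DdomE Dx i; have [] := df i x (Dx i).
have Ddg x : D x -> forall i, differentiable (grad (f i)) x.
  by move=> /DdomE Dx i; have [] := df i x (Dx i).
have [[Dxs Xxs] _] := xs_min; have [Dxk Xxk] := xkC.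
have nearD x : D x -> \near x, D x by move=> Dx; exact: open_nbhs_nbhs.
have nearDf x : D x -> \near x, forall i, differentiable (f i) x.
  by move=> /nearD; apply: filterS => y /Ddf.
pose A i := hess (f i) xstar.
have hsym x i : D x -> (hess (f i) x)^T = hess (f i) x.
  move=> Dx; apply: hess_sym; last exact: Ddg.
  by apply: filterS (nearDf _ Dx) => y /(_ i).
have symA i : (A i)^T = A i by exact: hsym.
have HsE : hess F xstar = n%:R^-1 *: \sum_i A i.
  by apply: hess_mean; [exact: nearDf | exact: Ddg].
have symHs : (hess F xstar)^T = hess F xstar.
  rewrite HsE linearZ /= raddf_sum /=; congr (_ *: _).
  by apply: eq_bigr => i _; exact: symA.
have Hs_ge v := lambda_min_dot_ge v symHs lmin.
have AK i : opbound (A i) Kst.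
  apply: opbound_le (opbound_specnorm (A i)).
  by rewrite KE; exact: (le_bigmax _ (fun i => specnorm (hess (f i) xstar)) i).
(* Testing on a basis vector gives [gst <= Kst]. Positivity of [Kst] makes the required sample size
   positive, hence [s > 0] below. *)
have K_gt0 : 0 < Kst.
  apply: lt_le_trans g0 _; pose v := evec R (Ordinal p0).
  have v1 : dot v v = 1 by rewrite /dot trmx_delta mul_delta_mx mxE.
  have HsK : opbound (hess F xstar) Kst by rewrite HsE; exact: opbound_mean.
  have := le_trans (Hs_ge v) (opbound_dot v v HsK).
  by rewrite -mulrA -expr2 sqr_enorm v1 !mulr1.
have t0 : 0 < gst * eps by rewrite mulr_gt0.
have s_ge' : 16 * Kst ^+ 2 * ln (2 * p%:R / delta) / (gst * eps) ^+ 2 <= s%:R.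
  by rewrite exprMn.
(* The bad event involves only Hessians at the fixed point [xstar]; outside it the bound holds
   deterministically for all admissible [M] and [y]. *)
apply: (prob_draw_ge n0 _ (mean_concentration p0 n0 d0 d1 K_gt0 t0 symA AK s_ge')).
move=> S /contrapT; rewrite -HsE => conc M y Mreg ymin.
have s0 : (0 < s)%N.
  rewrite -(ltr0n R); apply: lt_le_trans s_ge'.
  rewrite divr_gt0 ?exprn_gt0 // !mulr_gt0 ?exprn_gt0 // ln_gt0 // ltr_pdivlMr //.
  by have : 1 <= p%:R :> R by [rewrite ler1n]; lra.
pose e := xk - xstar; pose T : 'M[R]_p := s%:R^-1 *: \sum_j A (S j).
have segC x z t : (D `&` X) x -> (D `&` X) z -> 0 <= t <= 1 ->
    (D `&` X) (x + t *: (z - x)).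
  by move=> [Dx Xx] [Dz Xz] t01; split; exact: convex_set_segment.
have [yC _] := ymin.
have symM : M^T = M.
  by have [V [d [_ [_ ->]]]] := Mreg; exact: tr_conj_diag.
have meanD x : D x -> grad F x = n%:R^-1 *: \sum_(i < n) grad (f i) x.
  by move=> Dx; apply: grad_mean; exact: Ddf.
have e_seg t : 0 <= t <= 1 -> (D `&` X) (xstar + t *: e).
  by move=> t01; exact: segC.
have eK : xstar + e = xk by rewrite /e addrC subrK.
pose G := grad F xk - grad F xstar.
have symT : T^T = T.
  rewrite /T linearZ /= raddf_sum /=; congr (_ *: _).
  by apply: eq_bigr => j _; exact: symA.
have H_T : opbound (subH f S xk - T) (L * enorm e).
  rewrite /subH /T -scalerBr -sumrB; apply: opbound_mean => // j.
  exact: opbound_le (LipS _ _ xkC) (opbound_specnorm _).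
have incr : dot (y - xstar) (hess F xstar *m e - G) <=
    L / 2 * enorm e ^+ 2 * enorm (y - xstar).
  rewrite HsE /G (meanD _ Dxk) (meanD _ Dxs) -scalemxAl mulmx_suml -!scalerBr -!sumrB.
  rewrite dotZr ler_pdivrMl ?ltr0n // /dot mulmx_sumr summxE.
  rewrite mulr_natl -[n in leRHS]card_ord -sumr_const.
  apply: ler_sum => i _; rewrite -/(dot _ _) -eK.
  apply: grad_increment_le => t t01; first by apply: Ddg; have [] := e_seg t t01.
  apply: opbound_le (opbound_specnorm _).
  apply: le_trans (LipS _ i (e_seg t t01)) _.
  have /andP [t_ge0 _] := t01.
  by rewrite addrC addKr enormZ ger0_norm.
(* Sum of two first-order conditions: that of the model at [y] in the direction of [xstar], and that
   of [F] at [xstar] in the direction of [y]. *)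
have opt : dot (y - xstar) (M *m (y - xstar)) <= dot (y - xstar) (M *m e - G).
  have := argmin_qmodel_ge0 symM (fun t => segC y xstar t yC xs_min.1) ymin.
  have := local_min_grad_ge0 (fun t => segC xstar y t xs_min.1 yC) xs_min
    (differentiable_mean (Ddf _ Dxs)).
  have -> : y - xk = (y - xstar) - e by rewrite /e opprB addrA subrK.
  rewrite -[xstar - y]opprB; move: (y - xstar) => u.
  rewrite dotNr dotDl mulmxBr /G !(dotC _ u) !dotBr /F; lra.
exact: (regularized_step_le g0 e0 lam0 L0 lam_ge symT Hs_ge conc H_T Mreg incr opt).
Qed.
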